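(* Let $k$ be an algebraically closed field of characteristic $p>0$, let $\mathcal{O}$ be an order of a finite-dimensional semi-simple algebra over $\mathbb{Q}_p$, and let $(X,\iota)$ be a $p$-divisible $\mathcal{O}$-module over $k$. Let $\varphi:X_0\to X$ be the minimal isogeny of $X$ over $k$. Then there is a unique ring monomorphism $\iota_0:\mathcal{O}\to \mathrm{End}(X_0)$ such that $\varphi$ is $\mathcal{O}$-linear, i.e. $\varphi\circ\iota_0(a)=\iota(a)\circ\varphi$ for all $a\in\mathcal{O}$.
   Context: A $p$-divisible $\mathcal{O}$-module over $k$ is a pair $(X,\iota)$ where $X$ is a $p$-divisible group over $k$ and $\iota:\mathcal{O}\to\mathrm{End}(X)$ is a ring monomorphism. Let $W=W(k)$ be the ring of Witt vectors with Frobenius $\sigma$. A Dieudonné module over $k$ is a finite free $W$-module with a $\sigma$-linear operator $F$ and a $\sigma^{-1}$-linear operator $V$ such that $FV=VF=p$; covariant Dieudonné theory is used. For a pair $(a,b)\ne(0,0)$ of coprime non-negative integers put $n=a+b$ and let $\mathbf{M}_{(a,b)}$ be the Dieudonné module over $\mathbb{F}_p$ generated as a $\mathbb{Z}_p$-module by elements $e_i$ ($i\in\mathbb{Z}_{\ge0}$) with relations $e_{i+n}=pe_i$, and with $Fe_i=e_{i+b}$, $Ve_i=e_{i+a}$; the operators are extended to $\mathbf{M}_{(a,b)}\otimes_{\mathbb{Z}_p} W$ $\sigma$-linearly and $\sigma^{-1}$-linearly respectively. A Dieudonné module over $k$ is minimal if it is isomorphic to $\bigoplus_i (\mathbf{M}_{(a_i,b_i)}\otimes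 W)^{\oplus r_i}$ for some finite collection of such pairs $(a_i,b_i)$ and positive integers $r_i$. A $p$-divisible group over $k$ is minimal if its Dieudonné module is minimal. The minimal isogeny of a $p$-divisible group $X$ over $k$ is a pair $(X_0,\varphi)$ where $X_0$ is a minimal $p$-divisible group over $k$ and $\varphi:X_0\to X$ is an isogeny over $k$ such that for any other pair $(X_0',\varphi')$ consisting of a minimal $p$-divisible group $X_0'$ over $k$ and an isogeny $\varphi':X_0'\to X$ there exists an isogeny $\rho:X_0'\to X_0$ with $\varphi'=\varphi\circ\rho$. It exists for every $X$. *)

(* Defs.v *)
From HB Require Import structures.
From mathcomp Require Import all_boot all_order all_algebra all_field.
From mathcomp Require Import boolp finmap ring.
From mathcomp.multinomials Require monalg.

Set Implicit Arguments.
Unset Strict Implicit.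
Unset Printing Implicit Defensive.
Import GRing.Theory.
Local Open Scope ring_scope.

(* p-divisible groups over an algebraically closed field k of characteristic p
   are treated in the style of Demazure and Fontaine: a commutative formal k-group
   is a functor from finite (i.e. finite-dimensional) commutative k-algebras to
   abelian groups, and a p-divisible group X = colim X[p^n] is recovered from its
   functor of points on these algebras since each X[p^n] is finite.
   The (contravariant) Dieudonne module is Fontaine's M(X) = Hom(X, CW), where CW
   is the functor of Witt covectors; the covariant one is its W-linear dual. *)

Section UniversalRing.
Import monalg.

Definition mpol : comNzRingType := {malg int[{cmonom nat}]}.
Definition mvar (i : nat) : mpol := << ucm i >>%R.

Section Eval.
Variables (R : comNzRingType) (v : nat -> R).
Definition monev (m : {cmonom nat}) : R := \prod_(i <- finsupp m) v i ^+ m i.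

Lemma monevEw (d : {fset nat}) (m : {cmonom nat}) :
  (finsupp m `<=` d)%fset -> monev m = \prod_(i <- d) v i ^+ m i.
Proof.
move=> le; rewrite /monev; apply/big_fset_incl => // i _.
by rewrite mem_finsupp negbK => /eqP->; rewrite expr0.
Qed.

Fact monev_mmorphism : mmorphism monev.
Proof.
split=> [m n|]; last first.
  by rewrite (@monevEw fset0) ?mdom1 // big_seq_fset0.
pose d := (finsupp m `|` finsupp n)%fset.
rewrite (@monevEw d) ?mdomD // (@monevEw d m) ?fsubsetUl //.
rewrite (@monevEw d n) ?fsubsetUr // -big_split /=.
by apply: eq_bigr => i _; rewrite cmM exprD.
Qed.
HB.instance Definition _ := isMultiplicative.Build _ _ monev monev_mmorphism.

Definition mev (f : mpol) : R := mmap (intmul (1 : R)) monev f.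
HB.instance Definition _ := GRing.RMorphism.copy mev (mmap (intmul (1 : R)) monev).

Lemma mev_var i : mev (mvar i) = v i.
Proof.
rewrite /mev /mvar mmapU mul1r /monev mdomU big_seq_fset1.
by rewrite cmUU expr1.
Qed.
End Eval.
Arguments mev : simpl never.

Lemma mpol_ind (P : mpol -> Prop) :
  (forall i, P (mvar i)) -> P 1 -> (forall a, P a -> P (- a)) ->
  (forall a b, P a -> P b -> P (a + b)) -> (forall a b, P a -> P b -> P (a * b)) ->
  forall a, P a.
Proof.
move=> Pv P1 PN PD PM.
have P0 : P 0 by rewrite -(subrr 1); apply: PD => //; apply: PN.
have Pn n : P n%:R.
  by elim: n => // n IH; rewrite -addn1 natrD; apply: PD.
have Pz (z : int) : P z%:~R.
  by case: z => n; [exact: Pn | rewrite NegzE mulrNz; apply: PN; exact: Pn].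
have Pm (m : {cmonom nat}) : P << m >>%R.
  elim: {m}(mdeg m) {-2}m (erefl (mdeg m)) => [|n IH] m.
    by move=> /mdeg_eq0I ->; exact: P1.
  move=> dm; have [i mi] : exists i, m i != 0%N.
    apply: contrapT => /forallNP m0; suff m1 : m = mone by rewrite m1 mdeg1 in dm.
    by apply/eqP/cmP => i; rewrite cm1; apply: contrapT => /eqP /(m0 i).
  have em : m = mmul (ucm i) (divcm m (ucm i)).
    apply/eqP/cmP => j; rewrite cmM divcmE ucmE.
    by have [<-|] := eqVneq i j; rewrite ?subn0 // addnC subnK // lt0n.
  rewrite em; have -> : << mmul (ucm i) (divcm m (ucm i)) >>%R = mvar i * << divcm m (ucm i) >>%R.
    by rewrite malgM_def fgmulUU mulr1.
  refine (PM _ _ (Pv _) (IH _ _)).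
  by move: dm; rewrite {1}em mdegM mdegU add1n => -[].
move=> a; rewrite [a]monalgE; elim/big_rec: _ => // m b _ Pb.
refine (PD _ _ _ Pb).
have -> : << a@_m *g m >>%R = (a@_m)%:~R * << m >>%R :> mpol.
  rewrite -(rmorph_int (@malgC _ _)) intz mul_malgC.
  by apply/malgP => k; rewrite mcoeffU mcoeffZ mcoeffU mulrnAr mulr1.
exact: (PM _ _ (Pz _) (Pm _)).
Qed.

Lemma mpol_tf n (a : mpol) : (0 < n)%N -> n%:R * a = 0 -> a = 0.
Proof.
move=> n0 na; apply/malgP => k; move: (congr1 (mcoeff k) na).
rewrite mcoeff0 mulr_natl mcoeffMn => /eqP.
by rewrite Num.Theory.mulrn_eq0 => /orP[/eqP n0'|/eqP//]; rewrite n0' in n0.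
Qed.

End UniversalRing.

(* The polynomial ring Z[X_0, X_1, ...] is used only through the interface below
   and is kept opaque, as unfolding it makes unification diverge. *)
Record int_polynomials := IntPolynomials {
  ip_ring : comNzRingType;
  ip_var : nat -> ip_ring;
  ip_ev : forall (R : comNzRingType) (v : nat -> R), {rmorphism ip_ring -> R};
  ip_ev_var : forall (R : comNzRingType) (v : nat -> R) i, ip_ev v (ip_var i) = v i;
  ip_ind : forall P : ip_ring -> Prop,
    (forall i, P (ip_var i)) -> P 1 -> (forall a, P a -> P (- a)) ->
    (forall a b, P a -> P b -> P (a + b)) -> (forall a b, P a -> P b -> P (a * b)) ->
    forall a, P a;
  ip_torsion_free : forall n (a : ip_ring), (0 < n)%N -> n%:R * a = 0 -> a = 0 }.

Lemma int_polynomials_ex : int_polynomials.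
Proof. exact: (IntPolynomials (fun R v => mev_var v) mpol_ind mpol_tf). Qed.

Definition univ : comNzRingType := ip_ring int_polynomials_ex.
Definition uvar : nat -> univ := ip_var int_polynomials_ex.
Definition ev (R : comNzRingType) (v : nat -> R) : {rmorphism univ -> R} :=
  ip_ev int_polynomials_ex v.
Lemma ev_var (R : comNzRingType) (v : nat -> R) i : ev v (uvar i) = v i.
Proof. exact: ip_ev_var. Qed.
Lemma univ_ind (P : univ -> Prop) :
  (forall i, P (uvar i)) -> P 1 -> (forall a, P a -> P (- a)) ->
  (forall a b, P a -> P b -> P (a + b)) -> (forall a b, P a -> P b -> P (a * b)) ->
  forall a, P a.
Proof. exact: ip_ind. Qed.
Lemma univ_tf n (a : univ) : (0 < n)%N -> n%:R * a = 0 -> a = 0.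
Proof. exact: ip_torsion_free. Qed.

Lemma ev_unique (R : comNzRingType) (f g : {rmorphism univ -> R}) :
  (forall i, f (uvar i) = g (uvar i)) -> f =1 g.
Proof.
move=> fg; apply: univ_ind => //.
- by rewrite !rmorph1.
- by move=> a; rewrite !rmorphN => ->.
- by move=> a b; rewrite !rmorphD => -> ->.
- by move=> a b; rewrite !rmorphM => -> ->.
Qed.

(* Z_p as the inverse limit of the Z/p^n; [x n] is the residue of x in [0, p^n[. *)
Record padic_int (p : nat) (p_pr : prime p) := PadicInt {
  residue :> nat -> nat;
  residueP : forall n, residue n = (residue n.+1 %% p ^ n)%N }.

Section PadicInt.
Variables (p : nat) (p_pr : prime p).
Local Notation padic_int := (padic_int p_pr).
Implicit Types x y z : padic_int.

Lemma padic_intP x y : residue x =1 residue y -> x = y.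
Proof.
case: x y => [x xP] [y yP] /= /funext exy; subst y.
by congr (PadicInt _ _); apply: Prop_irrelevance.
Qed.

Lemma residue_mod x n : (x n %% p ^ n)%N = x n.
Proof. by rewrite [in RHS]residueP [in LHS]residueP modn_mod. Qed.

Lemma residue_le x m n : (m <= n)%N -> (x n %% p ^ m)%N = x m.
Proof.
elim: n => [|n IH]; first by rewrite leqn0 => /eqP->; rewrite residue_mod.
rewrite leq_eqVlt => /predU1P[->|]; first by rewrite residue_mod.
by rewrite ltnS => mn; rewrite -IH // [x n]residueP modn_dvdm ?dvdn_exp2l.
Qed.

Fact coherent (f : nat -> nat) :
  (forall n, f n.+1 = f n %[mod p ^ n]) ->
  forall n, (f n %% p ^ n = (f n.+1 %% p ^ n.+1) %% p ^ n)%N.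
Proof. by move=> fP n; rewrite modn_dvdm ?dvdn_exp2l // fP. Qed.

Definition padic_of f fP : padic_int := PadicInt p_pr (@coherent f fP).

Fact residueS x n : x n.+1 = x n %[mod p ^ n].
Proof. by rewrite -residueP residue_mod. Qed.

Fact zero_coherent n : 0 = 0 %[mod p ^ n]. Proof. by []. Qed.
Fact one_coherent n : 1 = 1 %[mod p ^ n]. Proof. by []. Qed.
Fact add_coherent x y n : (x n.+1 + y n.+1 = x n + y n %[mod p ^ n])%N.
Proof. by rewrite -modnDm !residueS modnDm. Qed.
Fact mul_coherent x y n : (x n.+1 * y n.+1 = x n * y n %[mod p ^ n])%N.
Proof. by rewrite -modnMm !residueS modnMm. Qed.
Fact residue_lt x n : (x n < p ^ n)%N.
Proof. by rewrite -residue_mod ltn_mod expn_gt0 prime_gt0. Qed.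
Fact opp_coherent x n : (p ^ n.+1 - x n.+1 = p ^ n - x n %[mod p ^ n])%N.
Proof.
apply/eqP; rewrite -(eqn_modDr (x n)) subnK ?(ltnW (residue_lt _ _)) // modnn.
rewrite -modnDmr -[(x n %% _)%N]residueS modnDmr subnK ?(ltnW (residue_lt _ _)) //.
by rewrite expnS modnMl.
Qed.

Definition padic_add x y := padic_of (add_coherent x y).
Definition padic_mul x y := padic_of (mul_coherent x y).
Definition padic_opp x := padic_of (opp_coherent x).

HB.instance Definition _ := gen_eqMixin padic_int.
HB.instance Definition _ := gen_choiceMixin padic_int.

Fact padic_addA : associative padic_add.
Proof. by move=> x y z; apply: padic_intP => n /=; rewrite modnDmr modnDml addnA. Qed.
Fact padic_addC : commutative padic_add.
Proof. by move=> x y; apply: padic_intP => n /=; rewrite addnC. Qed.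
Fact padic_add0 : left_id (padic_of zero_coherent) padic_add.
Proof. by move=> x; apply: padic_intP => n /=; rewrite mod0n add0n residue_mod. Qed.
Fact padic_addN : left_inverse (padic_of zero_coherent) padic_opp padic_add.
Proof.
move=> x; apply: padic_intP => n /=.
by rewrite modnDml subnK ?(ltnW (residue_lt _ _)) // modnn mod0n.
Qed.
Fact padic_mulA : associative padic_mul.
Proof. by move=> x y z; apply: padic_intP => n /=; rewrite modnMmr modnMml mulnA. Qed.
Fact padic_mulC : commutative padic_mul.
Proof. by move=> x y; apply: padic_intP => n /=; rewrite mulnC. Qed.
Fact padic_mul1 : left_id (padic_of one_coherent) padic_mul.
Proof. by move=> x; apply: padic_intP => n /=; rewrite modnMml mul1n residue_mod. Qed.
Fact padic_mulD : left_distributive padic_mul padic_add.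
Proof. by move=> x y z; apply: padic_intP => n /=; rewrite modnMml modnDm mulnDl. Qed.
Fact padic_1neq0 : padic_of one_coherent != padic_of zero_coherent.
Proof.
apply/eqP => /(congr1 (fun x : padic_int => x 1%N)) /=.
by rewrite mod0n expn1 modn_small // prime_gt1.
Qed.

HB.instance Definition _ := GRing.isZmodule.Build padic_int
  padic_addA padic_addC padic_add0 padic_addN.
HB.instance Definition _ := GRing.Zmodule_isComNzRing.Build padic_int
  padic_mulA padic_mulC padic_mul1 padic_mulD padic_1neq0.

Definition padic_unit : pred padic_int := [pred x | `[< exists y, y * x = 1 >]].
Definition padic_inv x : padic_int :=
  if pselect (exists y, y * x = 1) is left ex then sval (cid ex) else x.

Fact padic_mulV : {in padic_unit, left_inverse 1 padic_inv *%R}.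
Proof.
move=> x /asboolP ex; rewrite /padic_inv; case: pselect => // ex'.
exact: svalP (cid ex').
Qed.
Fact padic_unitP x y : y * x = 1 -> padic_unit x.
Proof. by move=> yx; apply/asboolP; exists y. Qed.
Fact padic_inv_out : {in [predC padic_unit], padic_inv =1 id}.
Proof. by move=> x /asboolPn nex; rewrite /padic_inv; case: pselect. Qed.

HB.instance Definition _ := GRing.ComNzRing_hasMulInverse.Build padic_int
  padic_mulV padic_unitP padic_inv_out.

Fact padic_idomain (x y : padic_int) : x * y = 0 -> (x == 0) || (y == 0).
Proof.
have nz z : z != 0 -> exists n, z n != 0%N.
  move=> /eqP nz; apply: contrapT => /forallNP z0; apply: nz.
  by apply: padic_intP => n /=; rewrite mod0n; move/negP: (z0 n); rewrite negbK => /eqP.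
move=> xy0; apply/norP => -[/nz[a xa] /nz[b yb]].
have: (x (a + b) * y (a + b) %% p ^ (a + b))%N = 0%N.
  by move/(congr1 (fun x : padic_int => x (a + b)%N)): xy0 => /= ->; rewrite mod0n.
have xa' : ~~ (p ^ a %| x (a + b))%N by rewrite /dvdn residue_le ?leq_addr.
have yb' : ~~ (p ^ b %| y (a + b))%N by rewrite /dvdn residue_le ?leq_addl.
have x0 : (0 < x (a + b))%N by rewrite lt0n; apply: contraNneq xa' => ->.
have y0 : (0 < y (a + b))%N by rewrite lt0n; apply: contraNneq yb' => ->.
move/eqP; rewrite -/(dvdn _ _) pfactor_dvdn ?muln_gt0 ?x0 // lognM //.
rewrite !pfactor_dvdn // -!ltnNge in xa' yb'.
by rewrite leqNgt -addSn leq_add // ltnW.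
Qed.

HB.instance Definition _ := GRing.ComUnitRing_isIntegral.Build padic_int padic_idomain.

Definition padic : fieldType := {fraction padic_int}.
End PadicInt.

Section Ghost.
Variables (p : nat) (p_pr : prime p).

Definition ghost (R : comNzRingType) (x : nat -> R) (n : nat) : R :=
  \sum_(i < n.+1) (p ^ i)%:R * x i ^+ (p ^ (n - i)).

Lemma ghost_map (R S : comNzRingType) (g : {rmorphism R -> S}) x n :
  g (ghost x n) = ghost (g \o x) n.
Proof.
by rewrite rmorph_sum; apply: eq_bigr => i _; rewrite rmorphM rmorphXn rmorph_nat.
Qed.

Lemma ghostE (R : comNzRingType) (x : nat -> R) n :
  ghost x n = \sum_(i < n) (p ^ i)%:R * x i ^+ (p ^ (n - i)) + (p ^ n)%:R * x n.
Proof. by rewrite /ghost big_ord_recr /= subnn expn0 expr1. Qed.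

Section Dwork.
Variables (A : comNzRingType) (phi : {rmorphism A -> A}).

Definition congp (n : nat) (a b : A) := exists c, a = b + (p ^ n)%:R * c.

Lemma congp_refl n a : congp n a a. Proof. by exists 0; rewrite mulr0 addr0. Qed.
Lemma congp_sym n a b : congp n a b -> congp n b a.
Proof. by move=> [c ->]; exists (- c); rewrite mulrN addrK. Qed.
Lemma congp_trans n a b c : congp n a b -> congp n b c -> congp n a c.
Proof. by move=> [d ->] [e ->]; exists (e + d); rewrite mulrDr addrA. Qed.
Lemma congpD n a b c d : congp n a b -> congp n c d -> congp n (a + c) (b + d).
Proof. by move=> [e ->] [f ->]; exists (e + f); rewrite mulrDr addrACA. Qed.
Lemma congpN n a b : congp n a b -> congp n (- a) (- b).
Proof. by move=> [e ->]; exists (- e); rewrite mulrN opprD. Qed.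
Lemma congpM n a b c d : congp n a b -> congp n c d -> congp n (a * c) (b * d).
Proof.
move=> [e ->] [f ->]; exists (b * f + e * d + e * ((p ^ n)%:R * f)); ring.
Qed.
Lemma congpX n m a b : congp n a b -> congp n (a ^+ m) (b ^+ m).
Proof.
move=> ab; elim: m => [|m IH]; first exact: congp_refl.
by rewrite !exprS; apply: congpM.
Qed.
Lemma congp_sum n m (f g : 'I_m -> A) :
  (forall i, congp n (f i) (g i)) -> congp n (\sum_i f i) (\sum_i g i).
Proof.
move=> fg; elim/big_rec2: _ => [|i a b _ ab]; first exact: congp_refl.
by apply: congpD.
Qed.
Lemma congp_scale n m a b : congp m a b -> congp (n + m) ((p ^ n)%:R * a) ((p ^ n)%:R * b).
Proof. by move=> [c ->]; exists c; rewrite expnD natrM; ring. Qed.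

Lemma congp_exp m a b : congp m.+1 a b -> congp m.+2 (a ^+ p) (b ^+ p).
Proof.
move=> ab; case: (ab) => c ac.
have: congp 1 (\sum_(i < p) a ^+ (p.-1 - i) * b ^+ i) (\sum_(i < p) b ^+ p.-1).
  apply: congp_sum => i; have ab1 : congp 1 a b.
    by exists ((p ^ m)%:R * c); rewrite ac expnS natrM expn1 mulrA.
  have -> : b ^+ p.-1 = b ^+ (p.-1 - i) * b ^+ i.
    by rewrite -exprD subnK // -ltnS prednK ?prime_gt0.
  by apply: congpM; [exact: congpX | exact: congp_refl].
case=> d; rewrite sumr_const card_ord => Hd.
have Hs := subrXX a b p.
exists (c * (b ^+ p.-1 + d)); rewrite -[LHS](subrK (b ^+ p)) Hs addrC; apply: congr1.
have -> : \sum_(i < p) a ^+ (p.-1 - i) * b ^+ i = p%:R * (b ^+ p.-1 + d).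
  by rewrite Hd expn1 mulrDr -[X in X + _]mulr_natl.
by rewrite ac [_ + _ * c]addrC addrK [(p ^ m.+2)%N]expnSr natrM; ring.
Qed.

Lemma congp_expn m a b : congp 1 a b -> congp m.+1 (a ^+ (p ^ m)) (b ^+ (p ^ m)).
Proof.
move=> ab; elim: m => [|m IH]; first by rewrite expn0 !expr1.
by rewrite expnSr !exprM; apply: congp_exp.
Qed.

Lemma congp_expD b c : congp 1 ((b + c) ^+ p) (b ^+ p + c ^+ p).
Proof.
rewrite exprDn (bigD1 ord0) // (bigD1 ord_max) /=; last first.
  by rewrite -val_eqE /= -lt0n prime_gt0.
rewrite subn0 subnn !expr0 mulr1 mul1r bin0 binn !mulr1n addrA.
have [d ->] : exists d, \sum_(i < p.+1 | (i != ord0) && (i != ord_max))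
    b ^+ (p - i) * c ^+ i *+ 'C(p, i) = p%:R * d.
  elim/big_ind: _ => [|u v [d ->] [e ->]|i /andP[i0 im]].
  - by exists 0; rewrite mulr0.
  - by exists (d + e); rewrite mulrDr.
  - have /dvdnP[q ->] : (p %| 'C(p, i))%N.
      apply: prime_dvd_bin => //; rewrite lt0n [_ != _]i0 /=.
      by rewrite ltn_neqAle [_ != _]im -ltnS ltn_ord.
    exists (b ^+ (p - i) * c ^+ i *+ q).
    by rewrite mulrnA -[LHS]mulr_natl.
by exists d; rewrite expn1.
Qed.

Local Notation frobP a := (congp 1 (phi a) (a ^+ p)).
Lemma frobP1 : frobP 1. 
Proof. by rewrite rmorph1 expr1n; exact: congp_refl. Qed.
Lemma frobPN a : frobP a -> frobP (- a).
Proof.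
have := congp_expD a (- a); rewrite subrr expr0n eqn0Ngt prime_gt0 //= => aN Ha.
rewrite rmorphN; apply: congp_trans (congpN Ha) _.
have := congpD (congp_refl 1 (- a ^+ p)) aN.
by rewrite addr0 addKr.
Qed.
Lemma frobPD a b : frobP a -> frobP b -> frobP (a + b).
Proof.
move=> Ha Hb; rewrite rmorphD; apply: congp_trans (congpD Ha Hb) _.
exact/congp_sym/congp_expD.
Qed.
Lemma frobPM a b : frobP a -> frobP b -> frobP (a * b).
Proof. by move=> Ha Hb; rewrite rmorphM exprMn; exact: congpM. Qed.

Hypothesis phiP : forall a, congp 1 (phi a) (a ^+ p).
Hypothesis A_tf : forall n a, (0 < n)%N -> n%:R * a = 0 :> A -> a = 0.

Lemma ghost_phi x n : congp n.+1 (phi (ghost x n)) (ghost x n.+1).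
Proof.
rewrite ghost_map [ghost x n.+1]ghostE -[ghost _ n]addr0; apply: congpD; last first.
  by exists (- x n.+1); rewrite mulrN subrr.
apply: congp_sum => i /=; have le_in : (i <= n)%N by rewrite -ltnS.
have := congp_scale i (congp_expn (n - i) (phiP (x i))).
by rewrite addnS subnKC // subSn // expnS exprM.
Qed.

Lemma ghost_divisible x g n :
  (forall m, congp m.+1 (phi (g m)) (g m.+1)) ->
  (forall i, (i < n)%N -> ghost x i = g i) ->
  exists c, g n = \sum_(i < n) (p ^ i)%:R * x i ^+ (p ^ (n - i)) + (p ^ n)%:R * c.
Proof.
move=> gP; case: n => [|n] xg.
  by exists (g 0%N); rewrite big_ord0 expn0 mul1r add0r.
have: congp n.+1 (g n.+1) (ghost x n.+1).
  apply: congp_trans (congp_sym (gP n)) _; rewrite -xg //; exact: ghost_phi.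
rewrite ghostE => -[c ->]; exists (x n.+1 + c).
by rewrite mulrDr addrA.
Qed.

Section Solve.
Variable g : nat -> A.

Definition dwork_next (x : nat -> A) n : A :=
  if pselect (exists c, g n = \sum_(i < n) (p ^ i)%:R * x i ^+ (p ^ (n - i))
                              + (p ^ n)%:R * c)
  is left ex then sval (cid ex) else 0.
Fixpoint dwork_seq n : seq A :=
  if n is n.+1 then rcons (dwork_seq n) (dwork_next (nth 0 (dwork_seq n)) n)
  else [::].
Definition dwork_sol n := (dwork_seq n.+1)`_n.

Lemma size_dwork_seq n : size (dwork_seq n) = n.
Proof. by elim: n => //= n IH; rewrite size_rcons IH. Qed.

Lemma nth_dwork_seq n i : (i < n)%N -> (dwork_seq n)`_i = dwork_sol i.
Proof.
elim: n => // n IH; rewrite ltnS leq_eqVlt => /predU1P[-> //|i_n].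
by rewrite /= nth_rcons size_dwork_seq i_n IH.
Qed.

Lemma ghost_dwork_sol :
  (forall m, congp m.+1 (phi (g m)) (g m.+1)) -> ghost dwork_sol =1 g.
Proof.
move=> gP n; elim/ltn_ind: n => n IH.
have [c gn] := ghost_divisible gP IH.
have E : \sum_(i < n) (p ^ i)%:R * dwork_sol i ^+ (p ^ (n - i)) =
  \sum_(i < n) (p ^ i)%:R * (dwork_seq n)`_i ^+ (p ^ (n - i)).
  by apply: eq_bigr => i _; rewrite nth_dwork_seq.
rewrite ghostE E /dwork_sol /= nth_rcons size_dwork_seq ltnn eqxx /dwork_next.
rewrite E in gn; case: pselect => [ex|nex]; last by case: nex; exists c.
by rewrite -(svalP (cid ex)).
Qed.
End Solve.

Lemma ghost_inj (x y : nat -> A) : ghost x =1 ghost y -> x =1 y.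
Proof.
move=> xy n; elim/ltn_ind: n => n IH; have := xy n; rewrite !ghostE.
under eq_bigr => i _ do rewrite IH //.
move/addrI => /eqP; rewrite -subr_eq0 -mulrBr => /eqP /A_tf xy0.
by apply/eqP; rewrite -subr_eq0 xy0 // expn_gt0 prime_gt0.
Qed.
End Dwork.

Definition ufrob : {rmorphism univ -> univ} := ev (fun i => uvar i ^+ p).

Lemma ufrobP a : congp 1 (ufrob a) (a ^+ p).
Proof.
apply: (univ_ind (P := fun a => congp 1 (ufrob a) (a ^+ p))) a => [i||||].
- by rewrite /ufrob ev_var; exact: congp_refl.
- exact: frobP1.
- exact: frobPN.
- exact: frobPD.
- exact: frobPM.
Qed.

Lemma ghost_solvable (g : nat -> univ) :
  (forall m, congp m.+1 (ufrob (g m)) (g m.+1)) -> exists z, ghost z =1 g.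
Proof. by move=> gP; exists (dwork_sol g); apply: ghost_dwork_sol ufrobP _ gP. Qed.

Definition ux (i : nat) := uvar i.*2.
Definition uy (i : nat) := uvar i.*2.+1.

Lemma witt_sum_ex : exists z, forall n, ghost z n = ghost ux n + ghost uy n.
Proof.
apply: ghost_solvable => m; rewrite rmorphD.
by apply: congpD; apply: (ghost_phi ufrobP).
Qed.
Lemma witt_prod_ex : exists z, forall n, ghost z n = ghost ux n * ghost uy n.
Proof.
apply: ghost_solvable => m; rewrite rmorphM.
by apply: congpM; apply: (ghost_phi ufrobP).
Qed.
Lemma witt_opp_ex : exists z, forall n, ghost z n = - ghost ux n.
Proof.
apply: ghost_solvable => m; rewrite rmorphN.
by apply: congpN; apply: (ghost_phi ufrobP).
Qed.

(* The universal Witt polynomials, characterized by their ghost components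
   (uniquely so, by [ghost_inj]). *)
Definition witt_sum := sval (cid witt_sum_ex).
Definition witt_prod := sval (cid witt_prod_ex).
Definition witt_opp := sval (cid witt_opp_ex).

Lemma ghost_sum n : ghost witt_sum n = ghost ux n + ghost uy n.
Proof. by rewrite /witt_sum; case: cid => z /= ->. Qed.
Lemma ghost_prod n : ghost witt_prod n = ghost ux n * ghost uy n.
Proof. by rewrite /witt_prod; case: cid => z /= ->. Qed.
Lemma ghost_wopp n : ghost witt_opp n = - ghost ux n.
Proof. by rewrite /witt_opp; case: cid => z /= ->. Qed.

(* The substitution X_{2i} := x_i, X_{2i+1} := y_i. *)
Definition interleave T (x y : nat -> T) (i : nat) : T :=
  if odd i then y i./2 else x i./2.

Section Ops.
Variable R : comNzRingType.
Implicit Types x y z : nat -> R.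

Definition gadd x y n : R := ev (interleave x y) (witt_sum n).
Definition gmul x y n : R := ev (interleave x y) (witt_prod n).
Definition gopp x n : R := ev (interleave x x) (witt_opp n).
Definition gzero (n : nat) : R := 0.
Definition gone (n : nat) : R := (n == 0)%N%:R.

Lemma ev_ux x y : ev (interleave x y) \o ux =1 x.
Proof. by move=> i; rewrite /= ev_var /interleave odd_double doubleK. Qed.
Lemma ev_uy x y : ev (interleave x y) \o uy =1 y.
Proof. by move=> i; rewrite /= ev_var /interleave /= odd_double uphalf_double. Qed.

Lemma ghost_ev v u n : ev v (ghost u n) = ghost (ev v \o u : nat -> R) n.
Proof. exact: (ghost_map (ev v)). Qed.

Lemma evD v a b : ev v (a + b) = ev v a + ev v b :> R. Proof. exact: rmorphD. Qed.
Lemma evM v a b : ev v (a * b) = ev v a * ev v b :> R. Proof. exact: rmorphM. Qed.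
Lemma evN v a : ev v (- a) = - ev v a :> R. Proof. exact: rmorphN. Qed.

Lemma ghost_ext x y : x =1 y -> ghost x =1 ghost y.
Proof. by move=> /funext ->. Qed.

Lemma ghost_add x y n : ghost (gadd x y) n = ghost x n + ghost y n.
Proof.
rewrite -[LHS](ghost_ev (interleave x y) witt_sum).
rewrite ghost_sum evD; congr (_ + _); rewrite ghost_ev; apply: ghost_ext.
  exact: ev_ux.
exact: ev_uy.
Qed.
Lemma ghost_mul x y n : ghost (gmul x y) n = ghost x n * ghost y n.
Proof.
rewrite -[LHS](ghost_ev (interleave x y) witt_prod).
rewrite ghost_prod evM; congr (_ * _); rewrite ghost_ev; apply: ghost_ext.
  exact: ev_ux.
exact: ev_uy.
Qed.
Lemma ghost_opp x n : ghost (gopp x) n = - ghost x n.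
Proof.
rewrite -[LHS](ghost_ev (interleave x x) witt_opp).
by rewrite ghost_wopp evN ghost_ev (ghost_ext (ev_ux x x)).
Qed.
Lemma ghost_zero n : ghost gzero n = 0.
Proof.
rewrite /ghost big1 // => i _; rewrite /gzero expr0n expn_eq0.
by rewrite (gtn_eqF (prime_gt0 p_pr)) mulr0.
Qed.
Lemma ghost_one n : ghost gone n = 1.
Proof.
rewrite /ghost big_ord_recl big1 /= => [|i _]; last first.
  by rewrite /gone /= expr0n expn_eq0 (gtn_eqF (prime_gt0 p_pr)) mulr0.
by rewrite /gone expr1n mulr1 addr0.
Qed.
End Ops.

Section Map.
Variables (R S : comNzRingType) (g : {rmorphism R -> S}).

Lemma ev_comp v : g \o ev v =1 ev (g \o v).
Proof. by apply: (@ev_unique _ (g \o ev v : {rmorphism _ -> _})) => i /=; rewrite !ev_var. Qed.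
Lemma interleave_comp (x y : nat -> R) :
  g \o interleave x y = interleave (g \o x) (g \o y).
Proof. by apply/funext => i; rewrite /interleave /=; case: odd. Qed.

Lemma map_gadd x y : g \o gadd x y = gadd (g \o x) (g \o y).
Proof. by apply/funext => n; rewrite /gadd -interleave_comp -ev_comp. Qed.
Lemma map_gmul x y : g \o gmul x y = gmul (g \o x) (g \o y).
Proof. by apply/funext => n; rewrite /gmul -interleave_comp -ev_comp. Qed.
Lemma map_gopp x : g \o gopp x = gopp (g \o x).
Proof. by apply/funext => n; rewrite /gopp -interleave_comp -ev_comp. Qed.
Lemma map_gzero : g \o @gzero R = @gzero S.
Proof. by apply/funext => n /=; rewrite rmorph0. Qed.
Lemma map_gone : g \o @gone R = @gone S.
Proof. by apply/funext => n /=; rewrite rmorph_nat. Qed.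
End Map.

Section Lift.
Variable R : comNzRingType.
Lemma univ_lift (x y z : nat -> R) : exists (f : {rmorphism univ -> R}) a b c,
  [/\ x = f \o a, y = f \o b & z = f \o c].
Proof.
exists (ev (interleave x (interleave y z))).
exists (fun i => uvar i.*2), (fun i => uvar i.*2.*2.+1), (fun i => uvar i.*2.+1.*2.+1).
split; apply/funext => i /=; rewrite ev_var /interleave /=.
- by rewrite odd_double doubleK.
- by rewrite odd_double uphalf_double odd_double doubleK.
- by rewrite odd_double uphalf_double /= odd_double uphalf_double.
Qed.
End Lift.

Lemma univ_eq (R : comNzRingType) (f : {rmorphism univ -> R}) (u v : nat -> univ) :
  (forall n, ghost u n = ghost v n) -> f \o u = f \o v.
Proof. by move=> uv; congr (f \o _); apply/funext/(ghost_inj univ_tf). Qed.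

Lemma gaddA (R : comNzRingType) : associative (@gadd R).
Proof.
move=> x y z; have [f [a [b [c [-> -> ->]]]]] := univ_lift x y z.
rewrite -(map_gadd f b c) -(map_gadd f a b) -(map_gadd f a) -(map_gadd f _ c).
by apply: univ_eq => n; rewrite !ghost_add addrA.
Qed.
Lemma gaddC (R : comNzRingType) : commutative (@gadd R).
Proof.
move=> x y; have [f [a [b [_ [-> -> _]]]]] := univ_lift x y x.
rewrite -(map_gadd f a b) -(map_gadd f b a).
by apply: univ_eq => n; rewrite !ghost_add addrC.
Qed.
Lemma gadd0 (R : comNzRingType) : left_id (@gzero R) (@gadd R).
Proof.
move=> x; have [f [a [_ [_ [-> _ _]]]]] := univ_lift x x x.
rewrite -(map_gzero f) -(map_gadd f _ a).
by apply: univ_eq => n; rewrite ghost_add ghost_zero add0r.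
Qed.
Lemma gaddN (R : comNzRingType) : left_inverse (@gzero R) (@gopp R) (@gadd R).
Proof.
move=> x; have [f [a [_ [_ [-> _ _]]]]] := univ_lift x x x.
rewrite -(map_gzero f) -(map_gopp f a) -(map_gadd f _ a).
by apply: univ_eq => n; rewrite ghost_add ghost_zero ghost_opp addNr.
Qed.
Lemma gmulA (R : comNzRingType) : associative (@gmul R).
Proof.
move=> x y z; have [f [a [b [c [-> -> ->]]]]] := univ_lift x y z.
rewrite -(map_gmul f b c) -(map_gmul f a b) -(map_gmul f a) -(map_gmul f _ c).
by apply: univ_eq => n; rewrite !ghost_mul mulrA.
Qed.
Lemma gmulC (R : comNzRingType) : commutative (@gmul R).
Proof.
move=> x y; have [f [a [b [_ [-> -> _]]]]] := univ_lift x y x.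
rewrite -(map_gmul f a b) -(map_gmul f b a).
by apply: univ_eq => n; rewrite !ghost_mul mulrC.
Qed.
Lemma gmul1 (R : comNzRingType) : left_id (@gone R) (@gmul R).
Proof.
move=> x; have [f [a [_ [_ [-> _ _]]]]] := univ_lift x x x.
rewrite -(map_gone f) -(map_gmul f _ a).
by apply: univ_eq => n; rewrite ghost_mul ghost_one mul1r.
Qed.
Lemma gmulD (R : comNzRingType) : left_distributive (@gmul R) (@gadd R).
Proof.
move=> x y z; have [f [a [b [c [-> -> ->]]]]] := univ_lift x y z.
rewrite -(map_gadd f a b) -(map_gmul f a c) -(map_gmul f b c).
rewrite -(map_gmul f _ c) -(map_gadd f (gmul a c)).
by apply: univ_eq => n; rewrite !(ghost_mul, ghost_add) mulrDl.
Qed.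
End Ghost.

Record witt (p : nat) (p_pr : prime p) (R : Type) := Witt { wcoord :> nat -> R }.

Section WittRing.
Variables (p : nat) (p_pr : prime p) (R : comNzRingType).
Local Notation W := (witt p_pr R).
Implicit Types x y z : W.

Lemma wittP x y : x =1 y -> x = y.
Proof. by case: x y => x [y] /funext /= ->. Qed.

HB.instance Definition _ := gen_eqMixin W.
HB.instance Definition _ := gen_choiceMixin W.

Definition wadd x y : W := Witt p_pr (gadd p_pr x y).
Definition wmul x y : W := Witt p_pr (gmul p_pr x y).
Definition wopp x : W := Witt p_pr (gopp p_pr x).
Definition wzero : W := Witt p_pr (@gzero R).
Definition wone : W := Witt p_pr (@gone R).

Fact waddA : associative wadd.
Proof. by move=> x y z; rewrite /wadd /= gaddA. Qed.
Fact waddC : commutative wadd.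
Proof. by move=> x y; rewrite /wadd gaddC. Qed.
Fact wadd0 : left_id wzero wadd.
Proof. by move=> [x]; rewrite /wadd gadd0. Qed.
Fact waddN : left_inverse wzero wopp wadd.
Proof. by move=> x; rewrite /wadd gaddN. Qed.
Fact wmulA : associative wmul.
Proof. by move=> x y z; rewrite /wmul /= gmulA. Qed.
Fact wmulC : commutative wmul.
Proof. by move=> x y; rewrite /wmul gmulC. Qed.
Fact wmul1 : left_id wone wmul.
Proof. by move=> [x]; rewrite /wmul gmul1. Qed.
Fact wmulD : left_distributive wmul wadd.
Proof. by move=> x y z; rewrite /wmul /wadd /= gmulD. Qed.
Fact wone_neq0 : wone != wzero.
Proof.
apply/eqP => /(congr1 (fun x : W => x 0%N)) /= /eqP.
by rewrite /gone /gzero oner_eq0.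
Qed.

HB.instance Definition _ := GRing.isZmodule.Build W waddA waddC wadd0 waddN.
HB.instance Definition _ := GRing.Zmodule_isComNzRing.Build W
  wmulA wmulC wmul1 wmulD wone_neq0.
End WittRing.

Section WittMap.
Variables (p : nat) (p_pr : prime p) (R S : comNzRingType) (g : {rmorphism R -> S}).

Definition wmap (x : witt p_pr R) : witt p_pr S := Witt p_pr (g \o x).

Fact wmap_additive : {morph wmap : x y / x - y}.
Proof.
by move=> x y; apply: wittP => n; rewrite /= -map_gopp -map_gadd.
Qed.
Fact wmap_multiplicative : monoid_morphism wmap.
Proof.
split=> [|x y]; apply: wittP => n /=; first by rewrite -(map_gone g).
by rewrite -map_gmul.
Qed.
HB.instance Definition _ := GRing.isZmodMorphism.Build _ _ wmap wmap_additive.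
HB.instance Definition _ := GRing.isMonoidMorphism.Build _ _ wmap wmap_multiplicative.
End WittMap.
Arguments wmap {p} p_pr {R S} g x.

Section Frobenius.
Variables (k : closedFieldType) (p : nat) (p_pr : prime p) (kp : p \in [pchar k]).

Fact pthroot_ex (x : k) : exists y, y ^+ p == x.
Proof.
have [y yP] := solve_monicpoly (fun i => if i == 0%N then x else 0) (prime_gt0 p_pr).
exists y; rewrite yP; case: (p) (prime_gt0 p_pr) => // q _.
by rewrite big_ord_recl /= big1 => [|i _]; rewrite ?mul0r // expr0 mulr1 addr0.
Qed.
Definition pthroot (x : k) : k := xchoose (pthroot_ex x).

Lemma pthrootK x : pthroot x ^+ p = x.
Proof. exact/eqP/(xchooseP (pthroot_ex x)). Qed.

Lemma pthroot_uniq x y : y ^+ p = x -> pthroot x = y.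
Proof.
move=> <-; apply: (fmorph_inj (pFrobenius_aut kp)).
by rewrite /= !pFrobenius_autE pthrootK.
Qed.

Fact pthroot_additive : {morph pthroot : x y / x - y}.
Proof.
move=> x y; apply: pthroot_uniq; rewrite -(pFrobenius_autE kp) rmorphB.
by rewrite /= !pFrobenius_autE !pthrootK.
Qed.
Fact pthroot_multiplicative : monoid_morphism pthroot.
Proof.
split=> [|x y]; apply: pthroot_uniq; first exact: expr1n.
by rewrite exprMn !pthrootK.
Qed.
HB.instance Definition _ := GRing.isZmodMorphism.Build _ _ pthroot pthroot_additive.
HB.instance Definition _ := GRing.isMonoidMorphism.Build _ _ pthroot pthroot_multiplicative.

Definition wfrob : {rmorphism witt p_pr k -> witt p_pr k} := wmap p_pr (pFrobenius_aut kp).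
Definition wfrobV : {rmorphism witt p_pr k -> witt p_pr k} := wmap p_pr pthroot.

Lemma wfrobK : cancel wfrob wfrobV.
Proof.
by move=> x; apply: wittP => n /=; apply: pthroot_uniq; rewrite pFrobenius_autE.
Qed.
Lemma wfrobVK : cancel wfrobV wfrob.
Proof. by move=> x; apply: wittP => n /=; rewrite pFrobenius_autE pthrootK. Qed.
End Frobenius.

(* The underlying space is some k^n, rather than an arbitrary finite-dimensional
   space, to keep the type of all finite k-algebras in the universe of k: natural
   transformations between functors on it can then form a [zmodType]. The zero
   algebra, at which a sheaf takes the value 0, is left out. *)
Record finalg (k : fieldType) := FinAlg {
  fa_dim : nat;
  fa_one : 'rV[k]_fa_dim;
  fa_mul : 'rV[k]_fa_dim -> 'rV[k]_fa_dim -> 'rV[k]_fa_dim;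
  fa_mulA : associative fa_mul;
  fa_mulC : commutative fa_mul;
  fa_mul1 : left_id fa_one fa_mul;
  fa_mulD : left_distributive fa_mul +%R;
  fa_scaleAl : forall (c : k) x y, c *: fa_mul x y = fa_mul (c *: x) y;
  fa_one_neq0 : fa_one != 0 }.

Definition fa_sort (k : fieldType) (A : finalg k) : Type := 'rV[k]_(fa_dim A).
Coercion fa_sort : finalg >-> Sortclass.

HB.instance Definition _ (k : fieldType) (A : finalg k) :=
  GRing.Lmodule.copy (fa_sort A) 'rV[k]_(fa_dim A).
HB.instance Definition _ (k : fieldType) (A : finalg k) :=
  GRing.Zmodule_isComNzRing.Build (fa_sort A)
    (@fa_mulA k A) (@fa_mulC k A) (@fa_mul1 k A) (@fa_mulD k A) (@fa_one_neq0 k A).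
HB.instance Definition _ (k : fieldType) (A : finalg k) :=
  GRing.Lmodule_isLalgebra.Build k (fa_sort A) (@fa_scaleAl k A).
HB.instance Definition _ (k : fieldType) (A : finalg k) :=
  GRing.Lalgebra_isComAlgebra.Build k (fa_sort A).

Record kgroup (k : fieldType) := KGroup {
  points :> finalg k -> zmodType;
  fmap : forall A B : finalg k, {lrmorphism A -> B} -> {additive points A -> points B};
  fmap_ext : forall (A B : finalg k) (f g : {lrmorphism A -> B}),
    f =1 g -> fmap f =1 fmap g;
  fmap_id : forall A : finalg k, fmap (idfun : {lrmorphism A -> A}) =1 id;
  fmap_comp : forall (A B C : finalg k) (f : {lrmorphism B -> C}) (g : {lrmorphism A -> B}),
    fmap (f \o g : {lrmorphism A -> C}) =1 fmap f \o fmap g }.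
Arguments fmap {k} X {A B} f : rename.

Record khom (k : fieldType) (X Y : kgroup k) := KHom {
  happ :> forall A : finalg k, X A -> Y A;
  happB : forall A : finalg k, {morph @happ A : x y / x - y};
  happ_nat : forall (A B : finalg k) (f : {lrmorphism A -> B}) (x : X A),
    @happ B (fmap X f x) = fmap Y f (@happ A x) }.
Arguments happ {k X Y} f A x : rename.

HB.instance Definition _ (k : fieldType) (X Y : kgroup k) (f : khom X Y) (A : finalg k) :=
  GRing.isZmodMorphism.Build (X A) (Y A) (happ f A) (@happB k X Y f A).

HB.instance Definition _ (k : fieldType) (X Y : kgroup k) := gen_eqMixin (khom X Y).
HB.instance Definition _ (k : fieldType) (X Y : kgroup k) := gen_choiceMixin (khom X Y).

Section Hom.
Variable k : fieldType.
Implicit Types X Y Z : kgroup k.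

Lemma khomP X Y (f g : khom X Y) : (forall A, f A =1 g A) -> f = g.
Proof.
case: f g => [f fB fN] [g gB gN] /= fg; have {}fg : f = g.
  by apply: functional_extensionality_dep => A; apply/funext/fg.
by case: _ / fg gB gN => gB gN; congr KHom; apply: Prop_irrelevance.
Qed.

Section HomZmod.
Variables X Y : kgroup k.
Implicit Types f g h : khom X Y.

Definition khom_zero : khom X Y.
Proof.
by apply: (@KHom _ X Y (fun A _ => 0)) => [A x y|A B f x]; rewrite ?subr0 ?raddf0.
Defined.
Definition khom_opp f : khom X Y.
Proof.
apply: (@KHom _ X Y (fun A x => - f A x)) => [A x y|A B u x] /=.
  by rewrite raddfB opprD.
by rewrite happ_nat raddfN.
Defined.
Definition khom_add f g : khom X Y.
Proof.
apply: (@KHom _ X Y (fun A x => f A x + g A x)) => [A x y|A B u x] /=.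
  by rewrite !raddfB opprD addrACA.
by rewrite !happ_nat raddfD.
Defined.

Fact khom_addA : associative khom_add.
Proof. by move=> f g h; apply: khomP => A x; apply: addrA. Qed.
Fact khom_addC : commutative khom_add.
Proof. by move=> f g; apply: khomP => A x; apply: addrC. Qed.
Fact khom_add0 : left_id khom_zero khom_add.
Proof. by move=> f; apply: khomP => A x; apply: add0r. Qed.
Fact khom_addN : left_inverse khom_zero khom_opp khom_add.
Proof. by move=> f; apply: khomP => A x; apply: addNr. Qed.
HB.instance Definition _ := GRing.isZmodule.Build (khom X Y)
  khom_addA khom_addC khom_add0 khom_addN.
End HomZmod.

Definition kid X : khom X X.
Proof. by apply: (@KHom _ X X (fun A x => x)). Defined.
Definition kcomp X Y Z (g : khom Y Z) (f : khom X Y) : khom X Z.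
Proof.
apply: (@KHom _ X Z (fun A x => g A (f A x))) => [A x y|A B u x].
  by rewrite !raddfB.
by rewrite !happ_nat.
Defined.

Definition kend X : Type := khom X X.
HB.instance Definition _ X := GRing.Zmodule.on (kend X).

Fact kcompA X : associative (fun g f : kend X => kcomp g f).
Proof. by move=> h g f; apply: khomP. Qed.
Fact kcomp1f X : left_id (kid X) (fun g f : kend X => kcomp g f).
Proof. by move=> f; apply: khomP. Qed.
Fact kcompf1 X : right_id (kid X) (fun g f : kend X => kcomp g f).
Proof. by move=> f; apply: khomP. Qed.
Fact kcompDl X : left_distributive (fun g f : kend X => kcomp g f) +%R.
Proof. by move=> f g h; apply: khomP. Qed.
Fact kcompDr X : right_distributive (fun g f : kend X => kcomp g f) +%R.
Proof. by move=> f g h; apply: khomP => A x; apply: (raddfD (happ f A)). Qed.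
HB.instance Definition _ X := GRing.Zmodule_isPzRing.Build (kend X)
  (@kcompA X) (@kcomp1f X) (@kcompf1 X) (@kcompDl X) (@kcompDr X).
End Hom.

(* Flatness is the equational criterion; faithfulness says that a (finitely
   generated) ideal I of R with I S = S is the unit ideal. *)
Definition faithfully_flat (R S : comNzRingType) (f : {rmorphism R -> S}) :=
  (forall n (r : 'rV[R]_n) (s : 'cV[S]_n), map_mx f r *m s = 0 ->
     exists m (C : 'M[R]_(n, m)) (t : 'cV[S]_m), s = map_mx f C *m t /\ r *m C = 0)
  /\ (forall n (r : 'rV[R]_n) (s : 'cV[S]_n), map_mx f r *m s = 1%:M ->
     exists t : 'cV[R]_n, r *m t = 1%:M).

(* Epimorphism of sheaves for the (finite) faithfully flat topology. *)
Definition kepi (k : fieldType) (X Y : kgroup k) (f : khom X Y) :=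
  forall (A : finalg k) (y : Y A), exists (B : finalg k) (u : {lrmorphism A -> B}),
    faithfully_flat u /\ exists x : X B, f B x = fmap Y u y.

(* The subfunctor P of X is representable by a finite k-algebra A, with universal
   point u. *)
Definition finite_subgroup (k : fieldType) (X : kgroup k)
    (P : forall A : finalg k, X A -> Prop) :=
  exists (A : finalg k) (u : X A), P A u /\
    forall (B : finalg k) (x : X B), P B x ->
      exists2 f : {lrmorphism A -> B}, fmap X f u = x &
        forall g : {lrmorphism A -> B}, fmap X g u = x -> g =1 f.

(* X is p-power torsion, p : X -> X is an epimorphism, and the X[p^n] are finite
   group schemes; the latter are then of order p^(nh) for some h. *)
Definition is_pdivisible (p : nat) (k : fieldType) (X : kgroup k) :=
  [/\ forall (A : finalg k) (x : X A), exists n, x *+ p ^ n = 0,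
      kepi (p%:R : kend X) &
      forall n, finite_subgroup (fun (A : finalg k) (x : X A) => x *+ p ^ n = 0)].

Record pdivisible (p : nat) (k : fieldType) := PDivisible {
  pdiv_group :> kgroup k;
  pdivP : is_pdivisible p pdiv_group }.

Definition isogeny (k : fieldType) (X Y : kgroup k) (f : khom X Y) :=
  kepi f /\ finite_subgroup (fun (A : finalg k) (x : X A) => f A x = 0).

Section Dieudonne.
Variables (k : closedFieldType) (p : nat) (p_pr : prime p) (kp : p \in [pchar k]).
Local Notation W := (witt p_pr k).
Local Notation sigma := (wfrob p_pr kp).
Local Notation sigmaV := (wfrobV p_pr kp).

Section Covectors.
Variable A : finalg k.
Implicit Types a b c : nat -> A.

(* A covector (..., a_{-1}, a_0) is represented by the function n |-> a_{-n}. It is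
   in CW(A) if the ideal generated by the a_{-n} for n >= r is nilpotent for some r. *)
Definition is_covector a :=
  exists r N, forall s : seq nat, size s = N -> all (leq r) s -> \prod_(i <- s) a i = 0.

(* The Witt vector of length m+1 with components a_{-n-m}, ..., a_{-n}. *)
Definition window a n m : witt p_pr A :=
  Witt p_pr (fun i => if (i <= m)%N then a (n + m - i)%N else 0).

Definition stationary (u : nat -> A) (c : A) :=
  exists m0, forall m, (m0 <= m)%N -> u m = c.

(* c = a + b in CW(A): c_{-n} is the limit of
   S_m(a_{-n-m}, ..., a_{-n}; b_{-n-m}, ..., b_{-n}). *)
Definition cov_add a b c :=
  forall n, stationary (fun m => wcoord (window a n m + window b n m) m) (c n).

(* c = l a in CW(A). The Witt vector (a_{-N}, ..., a_0) is identified with its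
   Verschiebung (0, a_{-N}, ..., a_0), and x * V y = V (F x * y), so that l has to
   act on vectors of length N+1 through sigma^{-N} l. *)
Definition cov_scale (l : W) a c :=
  forall n, stationary
    (fun m => wcoord (wmap p_pr (in_alg A) (iter (n + m) sigmaV l) * window a n m) m) (c n).

Lemma finalg_pchar : p \in [pchar A].
Proof.
by apply: (rmorph_pchar (in_alg A)).
Qed.
Local Notation Fr := (pFrobenius_aut finalg_pchar).

Lemma window_shift a n m : window (fun i => a i.+1) n m = window a n.+1 m.
Proof.
by apply: wittP => i /=; case: leqP => // im; rewrite addSn subSn // (leq_trans im) ?leq_addl.
Qed.
Lemma window_frob a n m : window (fun i => a i ^+ p) n m = wmap p_pr Fr (window a n m).
Proof.
by apply: wittP => i /=; case: leqP => _; rewrite ?rmorph0 ?pFrobenius_autE.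
Qed.

Lemma cov_add_shift a b c : cov_add a b c ->
  cov_add (fun n => a n.+1) (fun n => b n.+1) (fun n => c n.+1).
Proof.
move=> abc n; have [m0 m0P] := abc n.+1; exists m0 => m /m0P <-.
by rewrite !window_shift.
Qed.
Lemma cov_add_frob a b c : cov_add a b c ->
  cov_add (fun n => a n ^+ p) (fun n => b n ^+ p) (fun n => c n ^+ p).
Proof.
move=> abc n; have [m0 m0P] := abc n; exists m0 => m /m0P <-.
by rewrite !window_frob -rmorphD /= pFrobenius_autE.
Qed.
Lemma cov_scale_shift l a c : cov_scale l a c ->
  cov_scale (sigmaV l) (fun n => a n.+1) (fun n => c n.+1).
Proof.
move=> lac n; have [m0 m0P] := lac n.+1; exists m0 => m /m0P <-.
by rewrite window_shift -iterSr.
Qed.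
Lemma cov_scale_frob l a c : cov_scale l a c ->
  cov_scale (sigma l) (fun n => a n ^+ p) (fun n => c n ^+ p).
Proof.
move=> lac n; have [m0 m0P] := lac n; exists m0 => m /m0P <-.
rewrite window_frob -(pFrobenius_autE finalg_pchar).
rewrite -[RHS]/(wcoord (wmap p_pr Fr (_ * _)) m) rmorphM; congr (wcoord (_ * _) m).
have -> : iter (n + m) sigmaV (sigma l) = sigma (iter (n + m) sigmaV l).
  elim: (n + m)%N => //= i ->; by rewrite wfrobK wfrobVK.
apply: wittP => i /=; rewrite !pFrobenius_autE.
by rewrite -[RHS](rmorphXn (in_alg A)).
Qed.
Lemma is_covector_shift a : is_covector a -> is_covector (fun n => a n.+1).
Proof.
move=> [r [N aN]]; exists r, N => s sN rs.
rewrite -(big_map S predT a); apply: aN; rewrite ?size_map // all_map.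
by apply: sub_all rs => i /= /leqW.
Qed.
Lemma is_covector_frob a : is_covector a -> is_covector (fun n => a n ^+ p).
Proof.
move=> [r [N aN]]; exists r, N => s sN rs.
by rewrite prodrXl aN // expr0n gtn_eqF ?prime_gt0.
Qed.
End Covectors.

Section Module.
Variable X : kgroup k.

(* M(X) = Hom(X, CW). *)
Record covhom := CovHom {
  capp : forall A : finalg k, X A -> nat -> A;
  capp_cov : forall (A : finalg k) (x : X A), is_covector (capp x);
  capp_nat : forall (A B : finalg k) (f : {lrmorphism A -> B}) (x : X A) n,
    capp (fmap X f x) n = f (capp x n);
  capp_add : forall (A : finalg k) (x y : X A),
    cov_add (capp x) (capp y) (capp (x + y)) }.

Implicit Types f g h : covhom.

Definition covhom_add f g h :=
  forall (A : finalg k) (x : X A), cov_add (capp f x) (capp g x) (capp h x).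
Definition covhom_scale l f h :=
  forall (A : finalg k) (x : X A), cov_scale l (capp f x) (capp h x).

Definition covhomF f : covhom.
Proof.
apply: (@CovHom (fun A x n => capp f x n ^+ p)) => [A x|A B u x n|A x y].
- exact/is_covector_frob/capp_cov.
- by rewrite capp_nat rmorphXn.
- exact/cov_add_frob/capp_add.
Defined.
Definition covhomV f : covhom.
Proof.
apply: (@CovHom (fun A x n => capp f x n.+1)) => [A x|A B u x n|A x y].
- exact/(@is_covector_shift _ (capp f x))/capp_cov.
- by rewrite capp_nat.
- exact/cov_add_shift/capp_add.
Defined.

(* D(X) = Hom_W(M(X), W), with F d = sigma o d o V and V d = sigma^{-1} o d o F. *)
Record dieud := Dieud {
  dapp :> covhom -> W;
  dapp_add : forall f g h, covhom_add f g h -> dapp h = dapp f + dapp g;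
  dapp_scale : forall l f h, covhom_scale l f h -> dapp h = l * dapp f }.

HB.instance Definition _ := gen_eqMixin dieud.
HB.instance Definition _ := gen_choiceMixin dieud.
Implicit Types d e : dieud.

Lemma dieudP d e : d =1 e -> d = e.
Proof.
case: d e => [d dD dZ] [e eD eZ] /= /funext de.
by case: _ / de eD eZ => eD eZ; congr Dieud; apply: Prop_irrelevance.
Qed.

Definition dieud_zero : dieud.
Proof. by apply: (@Dieud (fun=> 0)) => *; rewrite ?addr0 ?mulr0. Defined.
Definition dieud_opp d : dieud.
Proof.
apply: (@Dieud (fun f => - d f)) => [f g h /dapp_add->|l f h /dapp_scale->].
  by rewrite opprD.
by rewrite mulrN.
Defined.
Definition dieud_add d e : dieud.
Proof.
apply: (@Dieud (fun f => d f + e f)) => [f g h fgh|l f h lfh].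
  by rewrite !(dapp_add _ fgh) addrACA.
by rewrite !(dapp_scale _ lfh) mulrDr.
Defined.
Definition dieud_scale (l : W) d : dieud.
Proof.
apply: (@Dieud (fun f => l * d f)) => [f g h /dapp_add->|m f h /dapp_scale->].
  by rewrite mulrDr.
by rewrite mulrCA.
Defined.

Fact dieud_addA : associative dieud_add.
Proof. by move=> *; apply: dieudP => f; apply: addrA. Qed.
Fact dieud_addC : commutative dieud_add.
Proof. by move=> *; apply: dieudP => f; apply: addrC. Qed.
Fact dieud_add0 : left_id dieud_zero dieud_add.
Proof. by move=> *; apply: dieudP => f; apply: add0r. Qed.
Fact dieud_addN : left_inverse dieud_zero dieud_opp dieud_add.
Proof. by move=> *; apply: dieudP => f; apply: addNr. Qed.
HB.instance Definition _ := GRing.isZmodule.Build dieud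
  dieud_addA dieud_addC dieud_add0 dieud_addN.

Fact dieud_scaleA l m d : dieud_scale l (dieud_scale m d) = dieud_scale (l * m) d.
Proof. by apply: dieudP => f; apply: mulrA. Qed.
Fact dieud_scale1 : left_id 1 dieud_scale.
Proof. by move=> d; apply: dieudP => f; apply: mul1r. Qed.
Fact dieud_scaleDr : right_distributive dieud_scale +%R.
Proof. by move=> l d e; apply: dieudP => f; apply: mulrDr. Qed.
Fact dieud_scaleDl d : {morph dieud_scale^~ d : l m / l + m}.
Proof. by move=> l m; apply: dieudP => f; apply: mulrDl. Qed.
HB.instance Definition _ := GRing.Zmodule_isLmodule.Build W dieud
  dieud_scaleA dieud_scale1 dieud_scaleDr dieud_scaleDl.

Definition dieudF d : dieud.
Proof.
apply: (@Dieud (fun f => sigma (d (covhomV f)))) => [f g h fgh|l f h lfh].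
  rewrite -rmorphD; congr (sigma _); apply: dapp_add => A x.
  exact: cov_add_shift.
rewrite (@dapp_scale d (sigmaV l) (covhomV f)) ?rmorphM ?wfrobVK // => A x.
exact: cov_scale_shift.
Defined.
Definition dieudV d : dieud.
Proof.
apply: (@Dieud (fun f => sigmaV (d (covhomF f)))) => [f g h fgh|l f h lfh].
  rewrite -rmorphD; congr (sigmaV _); apply: dapp_add => A x.
  exact: cov_add_frob.
rewrite (@dapp_scale d (sigma l) (covhomF f)) ?rmorphM ?wfrobK // => A x.
exact: cov_scale_frob.
Defined.
End Module.

(* Finite freeness and F V = V F = p are not part of this structure; they hold for
   the modules [mab a b] and are invariant under isomorphism. *)
Record fvmodule := FVModule {
  fv_sort :> lmodType W;
  fvF : fv_sort -> fv_sort;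
  fvV : fv_sort -> fv_sort;
  fvF_semilinear : forall (l : W) x y, fvF (l *: x + y) = sigma l *: fvF x + fvF y;
  fvV_semilinear : forall (l : W) x y, fvV (l *: x + y) = sigmaV l *: fvV x + fvV y }.

Definition dieudonne (X : kgroup k) : fvmodule.
Proof.
apply: (@FVModule (dieud X) (@dieudF X) (@dieudV X)) => l d e; apply: dieudP => f.
  by rewrite /= rmorphD rmorphM.
by rewrite /= rmorphD rmorphM.
Defined.

Definition fviso (M N : fvmodule) :=
  exists f : {linear M -> N}, [/\ bijective f,
    forall x, f (fvF x) = fvF (f x) & forall x, f (fvV x) = fvV (f x)].

Definition fvzero : fvmodule.
Proof.
by apply: (@FVModule 'rV[W]_0 (fun=> 0) (fun=> 0)) => *; rewrite scaler0 addr0.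
Defined.

Definition fvsum (M N : fvmodule) : fvmodule.
Proof.
apply: (@FVModule (M * N)%type (fun x => (fvF x.1, fvF x.2)) (fun x => (fvV x.1, fvV x.2))).
  by move=> l x y /=; rewrite !fvF_semilinear.
by move=> l x y /=; rewrite !fvV_semilinear.
Defined.

(* M_(a,b) (x) W, in the basis e_0, ..., e_(n-1); [mab_gen m] is e_m for any m. *)
Section Mab.
Variables a b : nat.
Local Notation n := (a + b)%N.

Definition mab_gen (m : nat) : 'rV[W]_n :=
  \row_(i < n) (if i == (m %% n)%N :> nat then p%:R ^+ (m %/ n) else 0).
Definition mab_semi (s : W -> W) (d : nat) (x : 'rV[W]_n) : 'rV[W]_n :=
  \sum_(i < n) s (x 0 i) *: mab_gen (i + d).

Lemma mab_semi_semilinear (s : {rmorphism W -> W}) d l x y :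
  mab_semi s d (l *: x + y) = s l *: mab_semi s d x + mab_semi s d y.
Proof.
rewrite /mab_semi scaler_sumr -big_split; apply: eq_bigr => i _ /=.
by rewrite !mxE rmorphD rmorphM scalerDl scalerA.
Qed.

Definition mab : fvmodule :=
  @FVModule _ (mab_semi sigma b) (mab_semi sigmaV a)
    (mab_semi_semilinear sigma b) (mab_semi_semilinear sigmaV a).
End Mab.

(* Multiplicities are given by repetitions in s, and [coprime 0 0] is false. *)
Definition minimal_dieudonne (M : fvmodule) :=
  exists2 s : seq (nat * nat), all (fun ab => coprime ab.1 ab.2) s &
    fviso M (foldr fvsum fvzero [seq mab ab.1 ab.2 | ab <- s]).

Definition minimal (X : kgroup k) := minimal_dieudonne (dieudonne X).

Definition minimal_isogeny (X0 X : pdivisible p k) (phi : khom X0 X) :=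
  [/\ minimal X0, isogeny phi &
      forall (X0' : pdivisible p k) (phi' : khom X0' X), minimal X0' -> isogeny phi' ->
        exists2 rho : khom X0' X0, isogeny rho & phi' = kcomp phi rho].
End Dieudonne.

Definition left_ideal (K : fieldType) (B : falgType K) (I : {vspace B}) :=
  ({:B} * I <= I)%VS.

Definition semisimple (K : fieldType) (B : falgType K) :=
  forall I : {vspace B}, left_ideal I ->
    exists2 J : {vspace B}, left_ideal J & (I + J)%VS = {:B}%VS /\ (I :&: J)%VS = 0%VS.

(* O is identified with a subring of B by j; it is a Z_p-lattice in B. *)
Definition is_order (p : nat) (p_pr : prime p) (B : falgType (padic p_pr)) (O : nzRingType)
    (j : {rmorphism O -> B}) :=
  injective j /\ exists n (e : 'I_n -> O),
    <<[seq j (e i) | i <- enum 'I_n]>>%VS = {:B}%VS /\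
    forall b : B, (exists a, j a = b) <->
      exists c : 'I_n -> padic_int p_pr, b = \sum_i (tofrac (c i) : padic p_pr) *: j (e i).

(* Main.v *)
Require Import Defs.
From HB Require Import structures.
From mathcomp Require Import all_boot all_order all_algebra all_field.
From mathcomp Require Import cyclic generic_quotient boolp.
Set Implicit Arguments.
Unset Strict Implicit.
Unset Printing Implicit Defensive.
Import GRing.Theory.
Local Open Scope ring_scope.

(** The universal property of the minimal isogeny phi : X0 -> X lifts isogenies
    into X, whereas iota a need not be an isogeny. It becomes one after a shift:
    a satisfies a nonzero polynomial over Q_p, so a + m is invertible in the
    finite-dimensional algebra for some natural number m, and clearing the
    denominators of the inverse gives c in the order with
    (a + m) c = c (a + m) = p^n ([order_shift_divides_pexp]). Then iota (a + m) is
    an isogeny of X, iota (a + m) o phi is an isogeny from the minimal group X0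
    to X, and it factors as phi o rho; put iota0 a = rho - m.

    The rest follows from phi being a monomorphism among p-divisible groups
    ([isogeny_mono]): its kernel is killed by some p^n, so phi o h = 0 forces
    p^n h = h o p^n = 0, and p^n is an epimorphism of the source of h. Hence
    iota0 a is unique, and uniqueness makes iota0 a ring morphism. It is injective
    because phi is an epimorphism and iota is injective.

    With groups given by their points on finite algebras, two facts take work.
    Points of a p-divisible group are separated by faithfully flat maps
    ([pdiv_separated]), which allows one to cancel epimorphisms ([kepi_cancel]); and
    a morphism whose kernel is killed by p^n has a finite kernel ([finite_kernel]):
    inside X[p^n] = Spec A the kernel is the locus where two maps A' -> A agree,
    hence Spec of a quotient of A ([finalg_quotient]). *)

(** * Faithfully flat ring morphisms *)

Lemma faithfully_flat_id (R : comNzRingType) :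
  faithfully_flat (idfun : {rmorphism R -> R}).
Proof.
split=> n r s; rewrite map_mx_id // => rs; last by exists s.
by exists 1%N, s, 1%:M; rewrite map_mx_id // mulmx1.
Qed.

(** The equational criterion, applied to each column of C in turn; the resulting
    D's are put side by side. *)
Lemma flat_matrix (R S : comNzRingType) (f : {rmorphism R -> S}) n m
    (r : 'rV[R]_n) (C : 'M[S]_(n, m)) :
  faithfully_flat f -> map_mx f r *m C = 0 ->
  exists m' (D : 'M[R]_(n, m')) (E : 'M[S]_(m', m)), C = map_mx f D *m E /\ r *m D = 0.
Proof.
move=> [flat _]; elim: m C => [|m IH] C rC.
  by exists 0%N, 0, 0; rewrite mulmx0; split=> //; apply/matrixP => i [].
have : map_mx f r *m @lsubmx _ n 1 m C = 0 by rewrite mulmx_lsub rC linear0.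
have : map_mx f r *m @rsubmx _ n 1 m C = 0 by rewrite mulmx_rsub rC linear0.
move=> /IH[m2 [D2 [E2 [C2 rD2]]]] /flat[m1 [D1 [E1 [C1 rD1]]]].
exists (m1 + m2)%N, (row_mx D1 D2), (block_mx E1 0 0 E2 : 'M_(m1 + m2, 1 + m)).
split; last by rewrite mul_mx_row rD1 rD2 row_mx0.
have := mul_row_block (map_mx f D1) (map_mx f D2) E1 0 0 E2.
by rewrite map_row_mx !mulmx0 addr0 add0r -C1 -C2 (@hsubmxK _ n 1 m) => ->.
Qed.

Lemma faithfully_flat_comp (R S T : comNzRingType)
    (g : {rmorphism S -> T}) (f : {rmorphism R -> S}) :
  faithfully_flat f -> faithfully_flat g ->
  faithfully_flat (g \o f : {rmorphism R -> T}).
Proof.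
move=> ff [gflat gfaith]; split=> n r s; rewrite map_mx_comp.
  move=> /gflat[m [C [t [-> rC]]]].
  have [m' [D [E [-> rD]]]] := flat_matrix ff rC.
  by exists m', D, (map_mx g E *m t); rewrite map_mxM -mulmxA (map_mx_comp f g D).
by move=> /gfaith[t]; case: ff => _ /[apply].
Qed.

(** If f x = 0 then the relation x * 1 = 0 in S comes from relations x C = 0 in R
    with f C *m t = 1; by faithfulness the entries of C generate the unit ideal, so
    x = 0. *)
Lemma faithfully_flat_inj (R S : comNzRingType) (f : {rmorphism R -> S}) :
  faithfully_flat f -> injective f.
Proof.
move=> [flat faith]; apply: raddf_inj => x fx0.
have [|m [C [t [/esym fC xC]]]] := flat 1%N x%:M 1%:M.
  by rewrite map_scalar_mx fx0 mulmx1 raddf0.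
have [s Cs] : exists s, C *m s = 1%:M by exact: faith fC.
have : x%:M *m (C *m s) = 0 by rewrite mulmxA xC mul0mx.
by rewrite Cs mulmx1 => /matrixP /(_ 0 0); rewrite !mxE.
Qed.

(** * Quotients of finite algebras *)

(** The carrier of a [finalg] has to be a space of row vectors, so A/I is presented
    by a matrix P with kernel I and a linear section S of it. *)
Section QuotientAlgebra.
Variables (k : fieldType) (A : finalg k) (d : nat).
Variables (P : 'M[k]_(fa_dim A, d)) (S : 'M[k]_(d, fa_dim A)).
Hypothesis SK : S *m P = 1%:M.
Hypothesis kerP_ideal : forall x y : A, (x : 'rV_(fa_dim A)) *m P = 0 ->
  (y * x : A) *m P = 0 :> 'rV_d.
Hypothesis proj1_neq0 : (1 : A) *m P != 0 :> 'rV_d.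

Definition qproj (x : A) : 'rV[k]_d := (x : 'rV_(fa_dim A)) *m P.
Definition qlift (x : 'rV[k]_d) : A := x *m S.

Lemma qliftK : cancel qlift qproj.
Proof. by move=> x; rewrite /qproj /qlift -mulmxA SK mulmx1. Qed.

Fact qproj_linear : linear qproj.
Proof. by move=> c x y; rewrite /qproj mulmxDl scalemxAl. Qed.
HB.instance Definition _ := GRing.isLinear.Build k A 'rV[k]_d *:%R qproj qproj_linear.

Fact qlift_linear : linear qlift.
Proof. by move=> c x y; rewrite /qlift mulmxDl -scalemxAl. Qed.
HB.instance Definition _ := GRing.isLinear.Build k 'rV[k]_d A *:%R qlift qlift_linear.

Lemma qprojM x y x' y' :
  qproj x = qproj x' -> qproj y = qproj y' -> qproj (x * y) = qproj (x' * y').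
Proof.
have mulr_proj z u v : qproj u = qproj v -> qproj (z * u) = qproj (z * v).
  move=> uv; apply/eqP; rewrite -subr_eq0 -raddfB -mulrBr; apply/eqP/kerP_ideal.
  by rewrite -[LHS]/(qproj (u - v)) raddfB /= uv subrr.
by move=> xx yy; rewrite (mulr_proj _ _ _ yy) ![_ * y']mulrC; exact: mulr_proj.
Qed.

Definition qmul (x y : 'rV[k]_d) : 'rV[k]_d := qproj (qlift x * qlift y).

Lemma qmul_proj x y : qmul (qproj x) (qproj y) = qproj (x * y).
Proof. by apply: qprojM; rewrite qliftK. Qed.

Fact qmulA : associative qmul.
Proof.
move=> x y z; rewrite -(qliftK x) -(qliftK y) -(qliftK z).
by rewrite !qmul_proj mulrA.
Qed.
Fact qmulC : commutative qmul.
Proof. by move=> x y; rewrite /qmul mulrC. Qed.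
Fact qmul1 : left_id (qproj 1) qmul.
Proof. by move=> x; rewrite -(qliftK x) qmul_proj mul1r. Qed.
Fact qmulD : left_distributive qmul +%R.
Proof. by move=> x y z; rewrite /qmul raddfD mulrDl raddfD. Qed.
Fact qscaleAl (c : k) x y : c *: qmul x y = qmul (c *: x) y.
Proof. by rewrite /qmul !linearZ /= -scalerAl linearZ. Qed.

Definition quotient_alg : finalg k :=
  FinAlg qmulA qmulC qmul1 qmulD qscaleAl proj1_neq0.

Definition quotient_proj (x : A) : quotient_alg := qproj x.
HB.instance Definition _ :=
  GRing.isLinear.Build k A quotient_alg *:%R quotient_proj qproj_linear.
Fact quotient_proj_monoid : monoid_morphism quotient_proj.
Proof. by split=> // x y; rewrite -[LHS]qmul_proj. Qed.
HB.instance Definition _ :=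
  GRing.isMonoidMorphism.Build A quotient_alg quotient_proj quotient_proj_monoid.

Section Lift.
Variables (B : finalg k) (h : {lrmorphism A -> B}).
Hypothesis h_ker : forall x : A, qproj x = 0 -> h x = 0.

Definition quotient_lift (x : quotient_alg) : B := h (qlift x).

Lemma quotient_liftE x : quotient_lift (quotient_proj x) = h x.
Proof.
apply/eqP; rewrite -subr_eq0 -raddfB; apply/eqP/h_ker.
by rewrite raddfB /= [X in X - _](qliftK (qproj x)) subrr.
Qed.

Fact quotient_lift_linear : linear quotient_lift.
Proof. by move=> c x y; rewrite /quotient_lift !linearP. Qed.
HB.instance Definition _ :=
  GRing.isLinear.Build k quotient_alg B *:%R quotient_lift quotient_lift_linear.
Fact quotient_lift_monoid : monoid_morphism quotient_lift.
Proof.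
split=> [|x y]; first by rewrite [LHS]quotient_liftE rmorph1.
by rewrite [LHS]quotient_liftE rmorphM.
Qed.
Definition quotient_morph : {lrmorphism quotient_alg -> B} :=
  HB.pack quotient_lift
    (GRing.isMonoidMorphism.Build quotient_alg B quotient_lift quotient_lift_monoid).
End Lift.
End QuotientAlgebra.

Section Quotient.
Variables (k : fieldType) (A : finalg k) (m : nat) (s : 'I_m -> A).

Definition mul_by (a x : A) : A := a * x.
Fact mul_by_linear a :
  linear (mul_by a : 'rV[k]_(fa_dim A) -> 'rV[k]_(fa_dim A)).
Proof. by move=> c x y; rewrite /mul_by mulrDr -scalerAr. Qed.
HB.instance Definition _ a :=
  GRing.isLinear.Build k 'rV[k]_(fa_dim A) 'rV[k]_(fa_dim A) *:%R (mul_by a) (mul_by_linear a).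

Definition ideal_mx : 'M[k]_(fa_dim A) := (\sum_(i < m) lin1_mx (mul_by (s i)))%MS.

Lemma ideal_mxP (x : A) :
  reflect (exists u : 'I_m -> A, x = \sum_i s i * u i)
          ((x : 'rV_(fa_dim A)) <= ideal_mx)%MS.
Proof.
apply: (iffP (@sub_sumsmxP k _ xpredT 1 _ (x : 'rV_(fa_dim A)) _)).
  by case=> u xu; exists u; rewrite xu; apply: eq_bigr => i _; rewrite mul_rV_lin1.
by case=> u ->; exists u; apply: eq_bigr => i _; rewrite mul_rV_lin1.
Qed.

(** A / (s_1, ..., s_m) with its universal property. The morphism h0 ensures that the
    ideal is proper, since a [finalg] is a nonzero ring. *)
Lemma finalg_quotient (B0 : finalg k) (h0 : {lrmorphism A -> B0}) :
  (forall i, h0 (s i) = 0) ->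
  exists (Q : finalg k) (q : {lrmorphism A -> Q}),
    (forall i, q (s i) = 0) /\
    forall (B : finalg k) (h : {lrmorphism A -> B}), (forall i, h (s i) = 0) ->
      exists2 h' : {lrmorphism Q -> B}, h' \o q =1 h &
        forall g : {lrmorphism Q -> B}, g \o q =1 h -> g =1 h'.
Proof.
move=> h0s; pose P := col_base (cokermx ideal_mx).
have PK : pinvmx P *m P = 1%:M by rewrite mulVpmx ?col_base_full.
have kerP (x : A) :
    (x : 'rV_(fa_dim A)) *m P = 0 <-> exists u : 'I_m -> A, x = \sum_i s i * u i.
  apply: (iff_trans _ (iff_sym (rwP (ideal_mxP x)))); rewrite submxE.
  have -> : x *m cokermx ideal_mx = x *m P *m row_base (cokermx ideal_mx).
    by rewrite -mulmxA mulmx_base.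
  split=> [->|/eqP xP]; first by rewrite mul0mx.
  by apply: (row_free_inj (row_base_free (cokermx ideal_mx))); rewrite mul0mx.
have ker_ideal (x y : A) : (x : 'rV_(fa_dim A)) *m P = 0 -> (y * x : A) *m P = 0 :> 'rV_ _.
  move=> /kerP[u ->]; apply/kerP; exists (fun i => y * u i).
  by rewrite mulr_sumr; apply: eq_bigr => i _; rewrite mulrCA.
have ker_h (B : finalg k) (h : {lrmorphism A -> B}) : (forall i, h (s i) = 0) ->
    forall x : A, qproj P x = 0 -> h x = 0.
  move=> hs x /kerP[u ->]; rewrite raddf_sum big1 // => i _.
  by rewrite /= rmorphM /= hs mul0r.
have proj1_neq0 : (1 : A) *m P != 0 :> 'rV_ _.
  by apply/eqP => /(ker_h _ h0 h0s) /eqP; rewrite rmorph1 oner_eq0.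
exists (quotient_alg PK ker_ideal proj1_neq0), (quotient_proj PK ker_ideal proj1_neq0).
split=> [i|B h hs].
  apply/(kerP (s i)); exists (fun j => (j == i)%:R).
  by rewrite (bigD1 i) //= eqxx mulr1 big1 ?addr0 // => j /negbTE->; rewrite mulr0.
exists (quotient_morph PK ker_ideal proj1_neq0 (ker_h B h hs)) => [x|g gh x].
  exact: (quotient_liftE PK _ _ (ker_h B h hs)).
by rewrite /= /quotient_lift -[LHS]/(g x) -gh /= /quotient_proj qliftK.
Qed.
End Quotient.

(** * Epimorphisms, p-divisible groups and isogenies *)

Section Epimorphisms.
Variable k : fieldType.
Implicit Types X Y Z : kgroup k.

Lemma kepi_id X : kepi (kid X).
Proof.
move=> A y; exists A, idfun; split; first exact: faithfully_flat_id.
by exists y; rewrite fmap_id.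
Qed.

Lemma kepi_comp X Y Z (g : khom Y Z) (f : khom X Y) :
  kepi g -> kepi f -> kepi (kcomp g f).
Proof.
move=> g_epi f_epi A z; have [B [u [u_ff [y gy]]]] := g_epi A z.
have [C [v [v_ff [x fx]]]] := f_epi B y.
exists C, (v \o u : {lrmorphism A -> C}); split; first exact: faithfully_flat_comp.
by exists x; rewrite /= fx happ_nat gy fmap_comp.
Qed.

Lemma kepi_compl X Y Z (g : khom Y Z) (f : khom X Y) : kepi (kcomp g f) -> kepi g.
Proof.
move=> gf_epi A z; have [B [u [u_ff [x gfx]]]] := gf_epi A z.
by exists B, u; split=> //; exists (f B x).
Qed.

Lemma kend_natE X m (A : finalg k) (x : X A) : (m%:R : kend X) A x = x *+ m.
Proof. by elim: m => [|m IH]; rewrite ?mulr0n // !mulrS -IH. Qed.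

Lemma kcomp_addr X Y Z (g : khom Y Z) (f f' : khom X Y) :
  kcomp g (f + f') = kcomp g f + kcomp g f'.
Proof. by apply: khomP => A x; apply: (raddfD (happ g A)). Qed.

Lemma kcomp_oppr X Y Z (g : khom Y Z) (f : khom X Y) : kcomp g (- f) = - kcomp g f.
Proof. by apply: khomP => A x; apply: (raddfN (happ g A)). Qed.

Lemma kcomp_subr X Y Z (g : khom Y Z) (f f' : khom X Y) :
  kcomp g (f - f') = kcomp g f - kcomp g f'.
Proof. by rewrite kcomp_addr kcomp_oppr. Qed.

Lemma kcomp_nat X Y (f : khom X Y) m : kcomp f (m%:R : kend X) = kcomp (m%:R : kend Y) f.
Proof. by apply: khomP => A x /=; rewrite !kend_natE raddfMn. Qed.
End Epimorphisms.

Section PDivisible.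
Variables (p : nat) (k : fieldType).
Implicit Types X Y Z : pdivisible p k.

Lemma pdiv_torsion X (A : finalg k) (x : X A) : exists n, x *+ p ^ n = 0.
Proof. by case: (Defs.pdivP X) => + _ _; apply. Qed.

Lemma pdiv_torsion_points X n :
  finite_subgroup (fun (A : finalg k) (x : X A) => x *+ p ^ n = 0).
Proof. by case: (Defs.pdivP X). Qed.

Lemma pdiv_kepi_pexp X n : kepi ((p ^ n)%:R : kend X).
Proof.
elim: n => [|n IH]; first exact: kepi_id.
by rewrite expnS natrM; apply: kepi_comp IH; case: (Defs.pdivP X).
Qed.

(** A point and 0 both lie in some X[p^n] = Spec C, so they are two morphisms C -> A;
    these agree if they agree after the injection A -> B. *)
Lemma pdiv_separated X (A B : finalg k) (u : {lrmorphism A -> B}) :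
  faithfully_flat u -> injective (fmap X u).
Proof.
move=> /faithfully_flat_inj u_inj; apply: raddf_inj => x ux0.
have [n xn] := pdiv_torsion x; have [C [w [_ w_univ]]] := pdiv_torsion_points X n.
have [f fx _] := w_univ A x xn; have [g g0 _] := w_univ A 0 (mul0rn _ _).
have [h _ h_uniq] := w_univ B 0 (mul0rn _ _).
rewrite -fx -g0; apply: fmap_ext => c; apply: u_inj.
have uf : u \o f =1 h by apply: (h_uniq (u \o f)); rewrite fmap_comp /= fx.
have ug : u \o g =1 h by apply: (h_uniq (u \o g)); rewrite fmap_comp /= g0 raddf0.
by rewrite [LHS]uf [RHS]ug.
Qed.

Lemma kepi_cancel (W V : kgroup k) Z (f : khom W V) (h : khom V Z) :
  kepi f -> kcomp h f = 0 -> h = 0.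
Proof.
move=> f_epi hf0; apply: khomP => A y; have [B [u [u_ff [x fx]]]] := f_epi A y.
apply: (pdiv_separated u_ff); rewrite -happ_nat -fx raddf0.
by rewrite -[LHS]/(kcomp h f B x) hf0.
Qed.

(** X[p^n] = Spec A has universal point u and Y[p^n] = Spec A' has universal point v.
    The points f u and 0 of Y[p^n] are maps g, e : A' -> A, and the point of X[p^n] given
    by h : A -> B lies in the kernel of f iff h g = h e. So the kernel is Spec of A
    modulo the ideal generated by the image of g - e, for which a basis of A' gives
    finitely many generators. *)
Lemma finite_kernel X Y (f : khom X Y) n :
  (forall (A : finalg k) (x : X A), f A x = 0 -> x *+ p ^ n = 0) ->
  finite_subgroup (fun (A : finalg k) (x : X A) => f A x = 0).
Proof.
move=> ker_f; have [A [u [un u_univ]]] := pdiv_torsion_points X n.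
have [A' [v [_ v_univ]]] := pdiv_torsion_points Y n.
have [|g gv _] := v_univ A (f A u); first by rewrite -raddfMn un raddf0.
have [e ev _] := v_univ A 0 (mul0rn _ _).
pose s (i : 'I_(fa_dim A')) : A := g (delta_mx 0 i : 'rV_ _) - e (delta_mx 0 i : 'rV_ _).
have ker_s (B : finalg k) (h : {lrmorphism A -> B}) :
    f B (fmap X h u) = 0 <-> forall i, h (s i) = 0.
  have -> : f B (fmap X h u) = fmap Y (h \o g) v by rewrite happ_nat -gv fmap_comp.
  have he0 : fmap Y (h \o e) v = 0 by rewrite fmap_comp /= ev raddf0.
  split=> [hg0 i|hs].
    have [h1 _ h1_uniq] := v_univ B 0 (mul0rn _ _).
    rewrite raddfB; apply/eqP; rewrite subr_eq0; apply/eqP.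
    by rewrite -[LHS]/((h \o g) _) (h1_uniq _ hg0) -(h1_uniq _ he0).
  rewrite -he0; apply: fmap_ext => c.
  rewrite [c]row_sum_delta !raddf_sum; apply: eq_bigr => i _ /=.
  by rewrite !linearZ; congr (_ *: _); apply/eqP; rewrite -subr_eq0 -raddfB /= hs.
have [h0 h0u _] := u_univ A 0 (mul0rn _ _).
have h0s : forall i, h0 (s i) = 0 by apply/ker_s; rewrite h0u raddf0.
have [Q [q [qs q_univ]]] := finalg_quotient h0s.
exists Q, (fmap X q u); split=> [|B x fx]; first exact/ker_s.
have [h hu h_uniq] := u_univ B x (ker_f B x fx).
have [|h' h'q h'_uniq] := q_univ B h; first by apply/ker_s; rewrite hu.
exists h' => [|g' g'u].
  rewrite -hu -[LHS]/((fmap X h' \o fmap X q) u) -fmap_comp.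
  exact: (@fmap_ext _ _ _ _ (h' \o q) h).
by apply: h'_uniq; apply: (h_uniq (g' \o q)); rewrite fmap_comp.
Qed.

(** The universal point of the kernel is p-power torsion, hence so are all its points,
    with the same exponent. *)
Lemma isogeny_exponent X Y (f : khom X Y) : isogeny f ->
  exists n, forall (A : finalg k) (x : X A), f A x = 0 -> x *+ p ^ n = 0.
Proof.
move=> [_ [A [u [_ u_univ]]]]; have [n un] := pdiv_torsion u.
by exists n => B x /u_univ[h <- _]; rewrite -raddfMn un raddf0.
Qed.

(** The difference d of h and h' has image in ker f, which is killed by some p^n. So
    d o p^n = p^n d = 0, and p^n can be cancelled on the right. *)
Lemma isogeny_mono X Y Z (f : khom X Y) (h h' : khom Z X) : isogeny f ->
  kcomp f h = kcomp f h' -> h = h'.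
Proof.
move=> /isogeny_exponent[n ker_f] fh; apply/eqP; rewrite -subr_eq0; apply/eqP.
apply: (kepi_cancel (@pdiv_kepi_pexp Z n)); apply: khomP => A x.
rewrite /= kend_natE 2!raddfMn -mulrnBl; apply: ker_f.
by rewrite raddfB /=; apply/eqP; rewrite subr_eq0 -[f A (h A x)]/(kcomp f h A x) fh.
Qed.

(** A divisor g of p^n in End(Y), on both sides, is an isogeny: g c = p^n makes it an
    epimorphism, and c g = p^n bounds its kernel. Composing with f adds the exponent of
    the kernel of f. *)
Lemma isogeny_comp_pexp X Y (f : khom X Y) (g c : kend Y) n :
  isogeny f -> g * c = (p ^ n)%:R -> c * g = (p ^ n)%:R -> isogeny (kcomp g f).
Proof.
move=> f_iso gc cg; have [f_epi _] := f_iso; have [m ker_f] := isogeny_exponent f_iso.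
split.
  apply: kepi_comp f_epi; apply: (@kepi_compl _ _ _ _ g c).
  by rewrite [kcomp _ _]gc; exact: pdiv_kepi_pexp.
apply: (@finite_kernel _ _ _ (n + m)) => A x /= gfx.
rewrite expnD mulrnA; apply: ker_f; rewrite raddfMn -kend_natE -cg /=.
by rewrite [LHS]/= gfx raddf0.
Qed.
End PDivisible.

(** * p-adic integers and orders *)

Lemma fractionP (R : idomainType) (x : {fraction R}) :
  exists a b, b != 0 /\ x = tofrac a / tofrac b.
Proof.
elim/quotW: x => y; exists (frac y).1, (frac y).2.
have y2 := denom_ratioP y; split=> //.
suff -> : tofrac (frac y).1 = (\pi_(FracField.type R) y)%qT * tofrac (frac y).2.
  by rewrite mulfK ?tofrac_eq0.
unlock tofrac; rewrite -[RHS]FracField.pi_mul; apply/eqP.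
rewrite FracField.equivf_def /FracField.mulf !numden_Ratio ?mulf_neq0 ?mulr1 ?mul1r //.
all: exact: oner_neq0.
Qed.

Section Padic.
Variables (p : nat) (p_pr : prime p).
Implicit Types x : padic_int p_pr.

Lemma residue_nat m n : (m%:R : padic_int p_pr) n = (m %% p ^ n)%N.
Proof. by elim: m => [//|m IH]; rewrite mulrS /= IH modnDm add1n. Qed.

(** An inverse is chosen modulo each p^n; the choices are compatible because inverses
    modulo p^n are unique. *)
Lemma padic_unit_inv x : x 1%N != 0%N -> exists y, y * x = 1.
Proof.
move=> x1; have co n : coprime (x n) (p ^ n).
  case: n => [|n]; first by rewrite coprimen1.
  rewrite coprime_sym coprime_pexpl // prime_coprime //.
  by rewrite /dvdn -[p in (_ %% p)%N]expn1 residue_le.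
have inv_ex n : exists y, (y * x n = 1 %[mod p ^ n])%N.
  exists (x n ^ (totient (p ^ n)).-1)%N; rewrite -expnSr prednK.
    by rewrite Euler_exp_totient.
  by rewrite totient_gt0 expn_gt0 prime_gt0.
pose y n := sval (cid (inv_ex n)).
have yP n : (y n * x n = 1 %[mod p ^ n])%N := svalP (cid (inv_ex n)).
have y_coh n : y n.+1 = y n %[mod p ^ n].
  have := yP n.+1 => /(congr1 (fun m => m %% p ^ n)%N).
  rewrite !modn_dvdm ?dvdn_exp2l // -modnMmr residueS modnMmr -yP => /eqP.
  have [le|le] := leqP (y n) (y n.+1).
    rewrite !eqn_mod_dvd ?leq_mul2r ?le ?orbT // -mulnBl Gauss_dvdl 1?coprime_sym //.
    by rewrite -eqn_mod_dvd // => /eqP.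
  have {}le := ltnW le; rewrite eq_sym !eqn_mod_dvd ?leq_mul2r ?le ?orbT //.
  by rewrite -mulnBl Gauss_dvdl 1?coprime_sym // -eqn_mod_dvd // => /eqP.
exists (padic_of p_pr y_coh); apply: padic_intP => n /=.
by rewrite modnMml yP.
Qed.

(** A nonzero p-adic integer is p^n times a unit, for n the largest exponent with
    vanishing residue. *)
Lemma padic_int_dvd_pexp x : x != 0 -> exists n y, y * x = (p ^ n)%:R.
Proof.
move=> x0; have [n xn] : exists n, x n.+1 != 0%N.
  apply: contrapT => /forallNP x_eq0; move/eqP: x0; apply; apply: padic_intP => n /=.
  by rewrite residueP; move/negP/negbNE/eqP: (x_eq0 n) => ->; rewrite !mod0n.
case: (ex_minnP (ex_intro (fun n => x n.+1 != 0%N) n xn)) => {xn}n xn n_min.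
have p0 n' : (0 < p ^ n')%N by rewrite expn_gt0 prime_gt0.
have xn0 : x n = 0%N.
  case: n xn n_min => [|n] _ n_min; first by rewrite -residue_mod modn1.
  by apply/eqP; apply: contraTT (ltnSn n) => /n_min; rewrite leqNgt.
have dvd i : (p ^ n %| x (n + i))%N by rewrite /dvdn residue_le ?leq_addr // xn0.
pose y i := (x (n + i) %/ p ^ n)%N.
have yE i : (y i * p ^ n = x (n + i))%N by rewrite divnK.
have y_coh i : y i.+1 = y i %[mod p ^ i].
  apply/eqP; rewrite -(eqn_pmul2r (p0 n)) !muln_modl -expnD [(i + n)%N]addnC !yE addnS.
  by rewrite residueS.
have xE : x = (p ^ n)%:R * padic_of p_pr y_coh.
  apply: padic_intP => i /=; rewrite residue_nat modnMml modnMmr mulnC yE.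
  by rewrite residue_le ?leq_addl.
have [|z zy] := @padic_unit_inv (padic_of p_pr y_coh).
  rewrite /= -(eqn_pmul2r (p0 n)) muln_modl -expnD mul0n yE addn1 add1n.
  by rewrite residue_mod.
by exists n, z; rewrite xE mulrCA zy mulr1.
Qed.

Lemma tofrac_nat m : tofrac (m%:R : padic_int p_pr) = m%:R :> padic p_pr.
Proof. exact: rmorph_nat. Qed.

Lemma padic_natr_eq0 m : ((m%:R : padic p_pr) == 0) = (m == 0)%N.
Proof.
rewrite -tofrac_nat tofrac_eq0; apply/eqP/eqP => [|->//].
move/(congr1 (fun x : padic_int p_pr => x m)); rewrite residue_nat /= mod0n.
by rewrite modn_small // ltn_expl // prime_gt1.
Qed.

Lemma padic_pexp_denom (x : padic p_pr) :
  exists n (y : padic_int p_pr), (p ^ n)%:R * x = tofrac y.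
Proof.
have [a [b [b0 ->]]] := fractionP x.
have [n [y yb]] := padic_int_dvd_pexp b0; exists n, (y * a).
by rewrite -tofrac_nat -yb !tofracM mulrACA divff ?mulr1 ?tofrac_eq0.
Qed.
End Padic.

Section Order.
Variables (p : nat) (p_pr : prime p) (B : falgType (padic p_pr)).
Variables (O : nzRingType) (j : {rmorphism O -> B}).

(** The powers of a are linearly dependent, so q(a) = 0 for some q != 0. As Q_p has
    characteristic 0, v = q(-m) is nonzero for some m; then X + m divides q - v, so
    that a + m divides -v, a unit. *)
Lemma shift_unit (a : B) : exists m (b : B), (a + m%:R) * b = 1 /\ b * (a + m%:R) = 1.
Proof.
pose d := \dim {:B}; pose X := [tuple a ^+ i | i < d.+1].
have /(elimN freeP)/existsNP[c] : ~~ free X.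
  apply/negP => /eqP dX; have := dimvS (subvf <<X>>).
  by rewrite dX size_tuple ltnn.
move=> /not_implyP[c_rel /existsNP[i ci]].
pose q := \poly_(i < d.+1) c (inord i).
have q0 : q != 0.
  apply/eqP => /(congr1 (fun q : {poly _} => q`_i)).
  by rewrite coef_poly ltn_ord inord_val coef0.
have qa : horner_alg a q = 0.
  rewrite -[RHS]c_rel /q poly_def raddf_sum; apply: eq_bigr => l _.
  rewrite /= linearZ /= rmorphXn /= horner_algX inord_val.
  by rewrite mulr_algl (nth_mktuple (fun i : 'I_d.+1 => a ^+ i) 0 l).
have [m qm] : exists m, q.[- m%:R] != 0.
  (* Otherwise 0, -1, ..., 1 - size q would be too many roots. *)
  apply: contrapT => /forallNP q_root.
  pose s : seq (padic p_pr) := [seq - i%:R | i <- iota 0 (size q)].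
  have := max_poly_roots q0 (rs := s); rewrite size_map size_iota ltnn => no_roots.
  suff: false by [].
  apply: no_roots.
    apply/allP => x /mapP[l _ ->]; rewrite /root; exact/negPn/negP.
  rewrite map_inj_uniq ?iota_uniq // => u v /oppr_inj uv.
  wlog le_uv : u v uv / (u <= v)%N.
    by move=> H; case: (leqP u v) => [/H->//|/ltnW/H->].
  apply/eqP; rewrite eqn_leq le_uv -subn_eq0 -(padic_natr_eq0 p_pr) natrB // uv.
  by rewrite subrr eqxx.
have /factor_theorem[r rE] : root (q - q.[- m%:R]%:P) (- m%:R).
  by rewrite /root !hornerE subrr.
pose v := q.[- m%:R]; pose b := - v^-1 *: horner_alg a r.
have b_of (u : B) : u = horner_alg a (q - v%:P) -> - v^-1 *: u = 1.
  move=> ->; rewrite raddfB /= qa horner_algC sub0r scalerN scaleNr opprK.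
  by rewrite scalerA mulVf ?scale1r.
have am : horner_alg a ('X - (- m%:R)%:P) = a + m%:R.
  by rewrite raddfB /= horner_algX horner_algC scaleNr opprK scaler_nat.
exists m, b; rewrite -am /b -scalerAl -scalerAr; split; apply: b_of.
  by rewrite rE mulrC rmorphM.
by rewrite rE rmorphM.
Qed.

(** The coordinates of b in the Q_p-generators e_i of B that span the order over Z_p
    are finitely many, so one power of p clears all their denominators. *)
Lemma order_denominator (b : B) : is_order j ->
  exists n c, j c = (p ^ n)%:R * b.
Proof.
move=> [_ [d [e [e_span e_lat]]]].
have : b \in <<[seq j (e i) | i <- enum 'I_d]>>%VS by rewrite e_span memvf.
have -> : [seq j (e i) | i <- enum 'I_d] = [tuple j (e i) | i < d] by [].
move=> /coord_span bE; set X := [tuple _ | _ < _] in bE.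
pose x i := coord X i b.
have /choice[n nP] i := padic_pexp_denom (x i).
pose N := (\sum_i n i)%N.
have /choice[y yP] i : exists y : padic_int p_pr, (p ^ N)%:R * x i = tofrac y.
  have [y yE] := nP i; exists ((p ^ (N - n i))%:R * y).
  rewrite tofracM tofrac_nat -yE mulrA -natrM -expnD subnK //.
  by rewrite /N (bigD1 i) //= leq_addr.
have [_ /(_ _)[|c jc]] := e_lat ((p ^ N)%:R * b); last by exists N, c.
exists y; rewrite bE mulr_sumr; apply: eq_bigr => i _.
by rewrite (nth_mktuple (j \o e) 0 i) -yP -scalerA scaler_nat mulr_natl.
Qed.

Lemma order_shift_divides_pexp (a : O) : is_order j ->
  exists m n c, (a + m%:R) * c = (p ^ n)%:R /\ c * (a + m%:R) = (p ^ n)%:R.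
Proof.
move=> Oj; have [m [b [ab ba]]] := shift_unit (j a).
have [n [c jc]] := order_denominator b Oj; exists m, n, c.
have jam : j (a + m%:R) = j a + m%:R by rewrite rmorphD rmorph_nat.
case: Oj => j_inj _.
split; apply: j_inj; rewrite rmorphM jc jam rmorph_nat.
  by rewrite mulr_natl mulrnAr ab.
by rewrite -mulrA ba mulr1.
Qed.
End Order.

(** * Transport of the action *)

(** Along a monomorphism phi, additivity and multiplicativity of a lift of iota can be
    checked after composing with phi. *)
Section Transport.
Variables (k : fieldType) (O : nzRingType) (X X0 : kgroup k).
Variables (iota : {rmorphism O -> kend X}) (phi : khom X0 X).
Hypothesis phi_mono : forall h h' : kend X0, kcomp phi h = kcomp phi h' -> h = h'.
Variable f : O -> kend X0.
Hypothesis fE : forall a, kcomp phi (f a) = kcomp (iota a) phi.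

Fact transport_zmod : zmod_morphism f.
Proof.
move=> a b; apply: phi_mono; rewrite kcomp_subr !fE rmorphB.
by apply: khomP.
Qed.
Fact transport_monoid : monoid_morphism f.
Proof.
split=> [|a b]; apply: phi_mono; rewrite fE; first by rewrite rmorph1; apply: khomP.
have fE_at c (A : finalg k) x : phi A (f c A x) = iota c A (phi A x).
  by rewrite -[LHS]/(kcomp phi (f c) A x) fE.
by rewrite rmorphM; apply: khomP => A x /=; rewrite !fE_at.
Qed.
Definition transport_morph : {rmorphism O -> kend X0} :=
  HB.pack f (GRing.isZmodMorphism.Build _ _ f transport_zmod)
            (GRing.isMonoidMorphism.Build _ _ f transport_monoid).
End Transport.

Theorem proposition4p7 (k : closedFieldType) (p : nat) (p_pr : prime p) (kp : p \in [pchar k])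
  (B : falgType (padic p_pr)) (B_ss : semisimple B)
  (O : nzRingType) (j : {rmorphism O -> B}) (O_order : is_order j)
  (X : pdivisible p k) (iota : {rmorphism O -> kend X}) (iota_inj : injective iota)
  (X0 : pdivisible p k) (phi : khom X0 X) (phi_min : minimal_isogeny p_pr kp phi) :
  exists2 iota0 : {rmorphism O -> kend X0},
    injective iota0 /\ (forall a, kcomp phi (iota0 a) = kcomp (iota a) phi) &
    forall iota1 : {rmorphism O -> kend X0},
      injective iota1 /\ (forall a, kcomp phi (iota1 a) = kcomp (iota a) phi) ->
      iota1 =1 iota0.
Proof.
have [X0_min phi_iso phi_univ] := phi_min.
have phi_mono (h h' : kend X0) : kcomp phi h = kcomp phi h' -> h = h' :=
  isogeny_mono phi_iso.
have /choice[f fE] a : exists g : kend X0, kcomp phi g = kcomp (iota a) phi.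
  have [m [n [c [ac ca]]]] := order_shift_divides_pexp a O_order.
  have am_iso : isogeny (kcomp (iota (a + m%:R)) phi).
    apply: (isogeny_comp_pexp (c := iota c) (n := n)) => //.
      by rewrite -rmorphM ac rmorph_nat.
    by rewrite -rmorphM ca rmorph_nat.
  have [g _ gE] := phi_univ _ _ X0_min am_iso.
  (* Multiplication by m commutes with phi, so the shift can be undone on X0. *)
  exists ((g : kend X0) - m%:R); rewrite kcomp_subr -gE kcomp_nat rmorphD rmorph_nat.
  by apply: khomP => A x; apply: addrK.
exists (transport_morph phi_mono fE) => [|iota1 [_ iota1E] a]; last first.
  by apply: (isogeny_mono phi_iso); rewrite iota1E fE.
split=> //; apply: raddf_inj => a fa0; apply: iota_inj; rewrite rmorph0.
apply: (kepi_cancel (proj1 phi_iso)); rewrite -fE.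
have -> : f a = 0 := fa0.
by apply: khomP => A x; apply: raddf0.
Qed.
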